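(* Let $(\Gamma,\imath)$ be a computable group (with $\Gamma$ countably infinite), and let $([F_n,\mathcal{Z}_n])_{n\geq 1}$ be a fixed computable normal Følner monotiling of $\Gamma$. Let $\Lambda$ be a finite alphabet, let $\mathbf{X}=(\mathrm{X},\Gamma)$ be a nonempty subshift with $\mathrm{X}\subseteq\Lambda^{\Gamma}$, and let $\mathcal{F}_{\Lambda}$ be the associated word presheaf, $\mathcal{F}_{\Lambda}(U)=\{\omega|_U:\omega\in\mathrm{X}\}$ for computable $U\subseteq\Gamma$. Then $$\widetilde{\mathrm{K}}(\mathcal{F}_{\Lambda})=h(\mathbf{X}),$$ where $h(\mathbf{X})$ is the topological entropy of $\mathbf{X}$ and $\widetilde{\mathrm{K}}(\mathcal{F}_{\Lambda})=\limsup_{n\to\infty}\max_{\omega\in\mathcal{F}_{\Lambda}(F_n)}\overline{\mathrm{K}}(\omega,F_n)$ is the asymptotic Kolmogorov complexity of $\mathcal{F}_{\Lambda}$ computed along the sequence $(F_n)_{n\geq 1}$.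
   Context: Conventions. All groups are discrete and countably infinite; $\mathrm{e}$ is the identity; $|\cdot|$ is cardinality; $\log$ is the logarithm to base $2$; $\mathbb{N}=\{1,2,\dots\}$. Computability of (partial) functions on $\mathbb{N}\cup\{0\}$, on tuples, and on finite words over finite alphabets is the usual notion (Turing computability). A subset of $\mathbb{N}$ is computable if its indicator function is computable. Computable spaces and groups. An indexing of a set $X$ is an injective map $\imath:X\to\mathbb{N}$ with $\imath(X)$ a computable subset of $\mathbb{N}$; $(X,\imath)$ is then a computable space. Functions between (products of) computable spaces are computable if the induced functions on indices are computable. A subset $Y\subseteq X$ is computable if it is the preimage under $\imath$ of a computable subset of $\mathbb{N}$. A computable group is a pair $(\Gamma,\imath)$ of a group $\Gamma$ and an indexing $\imath$ such that multiplication $\Gamma\times\Gamma\to\Gamma$ is computable. A sequence $(Z_n)_{n\ge1}$ of subsets of $\Gamma$ is computable if $(n,x)\mapsto\mathbf{1}_{Z_n}(x)$ is computable on $\mathbb{N}\times\Gamma$. A sequence $(F_n)_{n\ge1}$ of finite subsets is canonically computable if there is an algorithm that, given $n$, prints the finite set $\imath(F_n)$ and halts (equivalently, $n\mapsto\sum_{x\in \imath(F_n)}2^{x}$ is a total computable function). Følner monotilings. A sequence $(F_n)_{n\ge 1}$ of finite subsets of $\Gamma$ is a Følner sequence if for every finite $K\subseteq\Gamma$, $|\partial_K(F_n)|/|F_n|\to0$, where $\partial_K(F)=K^{-1}F\cap K^{-1}(\Gamma\setminus F)$ (equivalently, $|F_n\triangle gF_n|/|F_n|\to0$ for every $g\in\Gamma$).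 A monotiling $[F,\mathcal{Z}]$ of $\Gamma$ is a finite set $F\subseteq\Gamma$ (tile) together with a set $\mathcal{Z}\subseteq\Gamma$ (centers) such that $\{Fz:z\in\mathcal{Z}\}$ is a covering of $\Gamma$ by pairwise disjoint translates of $F$. A Følner monotiling is a sequence of monotilings $([F_n,\mathcal{Z}_n])_{n\ge1}$ with $(F_n)$ a Følner sequence. It is normal if $|F_n|/\log n\to\infty$ as $n\to\infty$ and $\mathrm{e}\in F_n$ for every $n$. It is computable if $(F_n)$ is canonically computable and $(\mathcal{Z}_n)$ is computable. Subshifts. A subshift $\mathbf{X}=(\mathrm{X},\Gamma)$ is a closed $\Gamma$-invariant subset $\mathrm{X}\subseteq\Lambda^{\Gamma}$ (product topology, $\Lambda$ finite discrete), with left action $(g\cdot\omega)(x)=\omega(xg)$ for $x,g\in\Gamma$, $\omega\in\mathrm{X}$. Topological entropy. For a finite open cover $\alpha$ of $\mathrm{X}$ put $H(\alpha)=\log\min\{\mathrm{card}\,\beta:\beta\subseteq\alpha\text{ a subcover}\}$, $g^{-1}\alpha=\{g^{-1}A:A\in\alpha\}$, $\alpha\vee\beta=\{A\cap B:A\in\alpha,B\in\beta\}$, and $\alpha^F=\bigvee_{g\in F}g^{-1}\alpha$ for finite $F\subseteq\Gamma$. The limit $h(\alpha,\Gamma)=\lim_{n\to\infty}H(\alpha^{F_n})/|F_n|$ exists and is independent of the Følner sequence $(F_n)$; $h(\mathbf{X})=\sup\{h(\alpha,\Gamma):\alpha\text{ a finite open cover of }\mathrm{X}\}$. Kolmogorov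 complexity. A decompressor $A$ is a computable partial function from finite binary words to finite words over $\Lambda$. For a finite $\Lambda$-word $w$, $\mathrm{K}^0_A(w)=\inf\{l(p):A(p)=w\}$ ($l(p)$ the length of $p$; $\infty$ if there is no such $p$). A decompressor $A^*$ is optimal if for every decompressor $A$ there is a constant $c$ with $\mathrm{K}^0_{A^*}(w)\le\mathrm{K}^0_A(w)+c$ for all words $w$; optimal decompressors exist (Kolmogorov), and one is fixed, denoted $A^*$. For a finite nonempty $U\subseteq\Gamma$ and $\omega:U\to\Lambda$, list the elements of $U$ in order of increasing index, $U=\{u_1,\dots,u_m\}$ with $\imath(u_1)<\dots<\imath(u_m)$; then $\mathrm{K}(\omega,U)=\mathrm{K}^0_{A^*}(\omega(u_1)\omega(u_2)\cdots\omega(u_m))$ and the mean Kolmogorov complexity is $\overline{\mathrm{K}}(\omega,U)=\mathrm{K}(\omega,U)/|U|$. *)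

(* Defs.v *)
From HB Require Import structures.
From mathcomp Require Import all_boot all_order all_algebra finmap.
From mathcomp Require Import all_classical all_reals all_analysis.

Set Implicit Arguments.
Unset Strict Implicit.
Unset Printing Implicit Defensive.

Import Order.TTheory GRing.Theory Num.Theory.
Import numFieldNormedType.Exports.

Local Open Scope classical_set_scope.
Local Open Scope ring_scope.

(* Computability on nat is given by Kleene's partial recursive functions.
   A partial function nat^k -> nat is represented by its graph. *)

Definition pgraph (k : nat) := k.-tuple nat -> nat -> Prop.

Definition comp_graph k m (f : pgraph m) (g : 'I_m -> pgraph k) : pgraph k :=
  fun x y => exists2 z : m.-tuple nat, forall i, g i x (tnth z i) & f z y.

Fixpoint primrec_graph_at k (f : pgraph k) (g : pgraph k.+2) (n : nat)
    (x : k.-tuple nat) (y : nat) : Prop :=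
  if n is n'.+1 then
    exists2 z, primrec_graph_at f g n' x z & g [tuple of n' :: z :: x] y
  else f x y.

Definition primrec_graph k (f : pgraph k) (g : pgraph k.+2) : pgraph k.+1 :=
  fun x y => primrec_graph_at f g (thead x) [tuple of behead x] y.

(* the least y with f (y, x) = 0, all earlier values being defined *)
Definition mu_graph k (f : pgraph k.+1) : pgraph k :=
  fun x y => f [tuple of y :: x] 0%N /\
    forall i, (i < y)%N -> exists v, f [tuple of i :: x] v.+1.

Inductive partial_recursive : forall k, pgraph k -> Prop :=
| PR_zero k : partial_recursive (fun (_ : k.-tuple nat) y => y = 0%N)
| PR_succ : partial_recursive (fun (x : 1.-tuple nat) y => y = (thead x).+1)
| PR_proj k (i : 'I_k) :
    partial_recursive (fun (x : k.-tuple nat) y => y = tnth x i)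
| PR_comp k m (f : pgraph m) (g : 'I_m -> pgraph k) :
    partial_recursive f -> (forall i, partial_recursive (g i)) ->
    partial_recursive (comp_graph f g)
| PR_primrec k (f : pgraph k) (g : pgraph k.+2) :
    partial_recursive f -> partial_recursive g ->
    partial_recursive (primrec_graph f g)
| PR_mu k (f : pgraph k.+1) :
    partial_recursive f -> partial_recursive (mu_graph f).

Definition total_computable k (f : k.-tuple nat -> nat) : Prop :=
  partial_recursive (fun x y => y = f x).

Definition computable_natset (A : set nat) : Prop :=
  total_computable (fun x : 1.-tuple nat => (thead x \in A : nat)).

(* Partial functions between words are option-valued, and words are numbered
   by [pickle]; off the numbers of words the numerical function is arbitrary. *)
Definition computable_words (S T : finType) (A : seq S -> option (seq T)) :=
  exists2 f : pgraph 1, partial_recursive f &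
    forall (p : seq S) y, f [tuple choice.pickle p] y <-> omap choice.pickle (A p) = Some y.

Section ComputableGroup.
Variable G : groupType.

(* Indices are positive: N is {1, 2, ...}. *)
Definition is_indexing (T : Type) (idx : T -> nat) : Prop :=
  [/\ injective idx, forall x, (0 < idx x)%N & computable_natset (range idx)].

Definition computable_group (idx : G -> nat) : Prop :=
  is_indexing idx /\
  exists2 f : 2.-tuple nat -> nat, total_computable f &
    forall x y, f [tuple idx x; idx y] = idx (x * y)%g.

(* Sequences are indexed by n >= 1; their value at 0 is never constrained. *)

Definition computable_sets (idx : G -> nat) (Z : nat -> set G) : Prop :=
  exists2 f : 2.-tuple nat -> nat, total_computable f &
    forall n x, (0 < n)%N -> f [tuple n; idx x] = (x \in Z n).

Definition canonically_computable (idx : G -> nat) (F : nat -> {fset G}) :=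
  exists2 f : 1.-tuple nat -> nat, total_computable f &
    forall n, (0 < n)%N -> f [tuple n] = (\sum_(x <- F n) 2 ^ idx x)%N.

Definition boundary (K F : set G) : set G :=
  [set (k^-1 * f)%g | k in K & f in F] `&`
  [set (k^-1 * f)%g | k in K & f in ~` F].

Definition log2 (R : realType) (x : R) : R := ln x / ln 2.

Definition folner (R : realType) (F : nat -> {fset G}) : Prop :=
  forall K : {fset G},
    (fun n => (#|` fset_set (boundary [set` K] [set` F n])|)%:R / (#|` F n|)%:R)
      @ \oo --> (0 : R).

Definition monotiling (F : {fset G}) (Z : set G) : Prop :=
  let translate z := [set (f * z)%g | f in [set` F]] in
  \bigcup_(z in Z) translate z = setT /\ trivIset Z translate.

Definition folner_monotiling (R : realType)
    (F : nat -> {fset G}) (Z : nat -> set G) : Prop :=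
  folner R F /\ forall n, (0 < n)%N -> monotiling (F n) (Z n).

Definition normal_sequence (R : realType) (F : nat -> {fset G}) : Prop :=
  (fun n => (#|` F n|)%:R / log2 (n%:R : R)) @ \oo --> +oo /\
  forall n, (0 < n)%N -> (1%g : G) \in F n.

Definition computable_monotiling (idx : G -> nat)
    (F : nat -> {fset G}) (Z : nat -> set G) : Prop :=
  canonically_computable idx F /\ computable_sets idx Z.

End ComputableGroup.

Section Subshift.
Variables (G : groupType) (L : finType).

Definition config := prod_topology (fun _ : G => discrete_topology L).

Definition shift_action (g : G) (w : config) : config := fun x => w (x * g)%g.

Definition subshift (X : set config) : Prop :=
  closed X /\ forall g w, X w -> X (shift_action g w).

(* The presheaf is only evaluated on finite sets, so its sections are encoded
   as finite functions. *)
Definition word_presheaf (X : set config) (U : {fset G}) :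
    set {ffun U -> L} :=
  [set [ffun u : U => w (val u)] | w in X].

(* A cover of X consists of subsets of X which are open in the subspace
   topology of X. *)
Definition covers (X : set config) (a : set (set config)) : Prop :=
  \bigcup_(A in a) A = X.

Definition finite_open_cover (X : set config) (a : set (set config)) : Prop :=
  [/\ finite_set a,
      forall A, a A -> exists2 O : set config, open O & A = X `&` O
    & covers X a].

Definition cover_pullback (X : set config) (g : G) (a : set (set config)) :
    set (set config) :=
  [set X `&` shift_action g @^-1` A | A in a].

Definition cover_join (a b : set (set config)) : set (set config) :=
  [set A `&` B | A in a & B in b].

Definition cover_iterate (X : set config) (a : set (set config))
    (F : {fset G}) : set (set config) :=
  \big[cover_join/[set X]]_(g <- F) cover_pullback X g a.

(* The infimum is a minimum, taken over a set of natural numbers. *)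
Definition cover_entropy (R : realType) (X : set config)
    (a : set (set config)) : R :=
  log2 (inf [set (#|` fset_set b|)%:R |
              b in [set b : set (set config) | b `<=` a /\ covers X b]]).

(* By the Ornstein-Weiss lemma the limit exists for every Folner sequence F,
   and does not depend on F. *)
Definition entropy_of_cover (R : realType) (F : nat -> {fset G})
    (X : set config) (a : set (set config)) : R :=
  limn (fun n => cover_entropy R X (cover_iterate X a (F n)) / (#|` F n|)%:R).

Definition topological_entropy (R : realType) (F : nat -> {fset G})
    (X : set config) : \bar R :=
  ereal_sup [set (entropy_of_cover R F X a)%:E | a in finite_open_cover X].

End Subshift.

Arguments word_presheaf {G L} X U _.

Section KolmogorovComplexity.
Variables (R : realType) (L : finType).

Definition decompressor (A : seq bool -> option (seq L)) : Prop :=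
  computable_words A.

Definition K0 (A : seq bool -> option (seq L)) (w : seq L) : \bar R :=
  ereal_inf [set ((size p)%:R)%:E | p in [set p | A p = Some w]].

Definition optimal_decompressor (A : seq bool -> option (seq L)) : Prop :=
  decompressor A /\
  forall B, decompressor B ->
    exists c : R, forall w, (K0 A w <= K0 B w + c%:E)%E.

Variables (G : groupType) (idx : G -> nat) (A : seq bool -> option (seq L)).

Definition section_word (U : {fset G}) (w : {ffun U -> L}) : seq L :=
  [seq w u | u <- sort (fun u v : U => (idx (val u) <= idx (val v))%N)
                       (enum {: U})].

Definition mean_complexity (U : {fset G}) (w : {ffun U -> L}) : \bar R :=
  (K0 A (section_word w) * ((#|` U|)%:R^-1)%:E)%E.

Definition asymptotic_complexity (F : nat -> {fset G})
    (X : set (config G L)) : \bar R :=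
  limn_esup (fun n =>
    \big[maxe/-oo%E]_(w in word_presheaf X (F n)) mean_complexity w).

End KolmogorovComplexity.

(* Main.v *)
Require Import Defs.
From mathcomp Require Import all_boot all_order all_algebra finmap.
From mathcomp Require Import all_classical all_reals all_analysis.
From mathcomp Require Import zify lra.

(** Write [a n] for the rate [log2 W(F n) / |F n|], where [W(U)] is the number
    of words that configurations of [X] show on [U]. Both sides of the theorem
    equal [h = inf (a k)], which is also the limit of [a n].

    The combinatorial core is the set [tiled_words] of all words on [F n] that
    show a word of [X] on every translate of a fixed tile [F k] lying inside
    [F n], and are arbitrary elsewhere. By shift invariance it contains the
    words of [X]. As the translates are disjoint and miss only points close to
    the boundary of [F n], its cardinality is at most
    [W(F k) ^ (|F n| / |F k|)] up to a factor that is subexponential in [|F n|]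
    by the Folner condition ([log_card_tiled_words]). Hence
    [a n <= tiled_rate k n <= a k + o(1)], and [a] converges to its infimum
    ([cvg_word_rate]).

    Topological entropy. The cover of [X] by the values at the identity
    separates words exactly: the iterate along [U] needs [W(U)] elements
    ([cover_entropy_symbol_cover]). By compactness any other open cover is
    refined by the words on some finite [K], so its iterate along [F n] needs
    at most as many elements as there are words on [F n] together with
    [K F n], which exceeds [F n] by [o(|F n|)] points only ([entropy_of_cover_le]).

    Lower bound for complexity. Fewer than [2 ^ k] programs are shorter than
    [k], so some word on [F n] has complexity at least [log2 W(F n) - 1]
    ([exists_complex_word]).

    Upper bound for complexity. The set [X] itself need not be computable, but
    the words of [X] on the single tile [F k] form a finite set, which a
    decompressor may contain as a constant; this is what makes the words tiled
    by [F k] decidable, uniformly in [n], from the computable monotiling. A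
    tiled word on [F n] is then determined by [n] and its position in the list
    of all tiled words, so that its complexity is at most
    [2 log2 n + log2 #|tiled_words|] up to a constant
    ([complexity_computable_family], [complexity_tiled_words]). Normality makes
    [log2 n] negligible against [|F n|], and letting [k] vary gives the bound
    [h]. *)

Set Implicit Arguments.
Unset Strict Implicit.
Unset Printing Implicit Defensive.

Import Order.TTheory GRing.Theory Num.Theory.
Import numFieldNormedType.Exports.

Local Open Scope classical_set_scope.

(** * Closure properties of computable functions *)

Lemma total_computable_comp k m (f : m.-tuple nat -> nat)
    (g : 'I_m -> k.-tuple nat -> nat) :
  total_computable f -> (forall i, total_computable (g i)) ->
  total_computable (fun x => f [tuple g i x | i < m]).
Proof.
move=> cf cg; have := PR_comp cf cg; congr partial_recursive.
apply/funext => x; apply/funext => y; apply/propext; split=> [[z zg ->]|->].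
  by congr f; apply: eq_from_tnth => i; rewrite tnth_mktuple zg.
by exists [tuple g i x | i < m] => // i; rewrite tnth_mktuple.
Qed.

Lemma total_computable_primrec k (f : k.-tuple nat -> nat)
    (g : k.+2.-tuple nat -> nat) :
  total_computable f -> total_computable g ->
  total_computable (fun x : k.+1.-tuple nat =>
    iteri (thead x) (fun i z => g [tuple of i :: z :: [tuple of behead x]])
      (f [tuple of behead x])).
Proof.
move=> cf cg; have := PR_primrec cf cg; congr partial_recursive.
apply/funext => x; apply/funext => y; rewrite /primrec_graph; apply/propext.
elim: (thead x) y => [|n IHn] y //=; split=> [[z /IHn -> ->]//|->].
by eexists; first exact/IHn.
Qed.

Lemma nth_mktuple_ord m (f : 'I_m -> nat) i (im : (i < m)%N) :
  nth 0%N [tuple f j | j < m] i = f (Ordinal im).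
Proof. by rewrite -[i in LHS]/(nat_of_ord (Ordinal im)) nth_mktuple. Qed.

(** Functions of a list of arguments, in which [nth 0 s i] plays the part of the
    i-th variable. Leaving the arity free spares the bookkeeping of tuples:
    binding a variable is adding a head to the list. *)
Definition computable_fun (f : seq nat -> nat) : Prop :=
  forall k, total_computable (fun x : k.-tuple nat => f x).

Lemma eq_computable_fun f g : f =1 g -> computable_fun f -> computable_fun g.
Proof. by move=> /funext ->. Qed.

Lemma computable_var i : computable_fun (nth 0%N ^~ i).
Proof.
move=> k; have [ik|ki] := ltnP i k.
  have := PR_proj (Ordinal ik); congr partial_recursive.
  by apply/funext => x; apply/funext => y; rewrite (tnth_nth 0%N).
have := PR_zero k; congr partial_recursive.
by apply/funext => x; apply/funext => y; rewrite nth_default ?size_tuple.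
Qed.

Lemma computable_total m (f : m.-tuple nat -> nat) (g : 'I_m -> seq nat -> nat) :
  total_computable f -> (forall i, computable_fun (g i)) ->
  computable_fun (fun s => f [tuple g i s | i < m]).
Proof.
by move=> cf cg k; apply: (total_computable_comp cf) => i; apply: cg.
Qed.

Lemma computable_total1 (f : 1.-tuple nat -> nat) a :
  total_computable f -> computable_fun a ->
  computable_fun (fun s => f [tuple a s]).
Proof.
move=> cf ca; have := computable_total cf (fun=> ca).
apply: eq_computable_fun => s; congr f; apply: eq_from_tnth => i.
by rewrite tnth_mktuple (tnth_nth 0%N) (ord1 i).
Qed.

Lemma computable_total2 (f : 2.-tuple nat -> nat) a b :
  total_computable f -> computable_fun a -> computable_fun b ->
  computable_fun (fun s => f [tuple a s; b s]).
Proof.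
move=> cf ca cb; pose g (i : 'I_2) := if i == ord0 then a else b.
have cg i : computable_fun (g i) by rewrite /g; case: ifP.
have := computable_total cf cg.
apply: eq_computable_fun => s; congr f; apply: eq_from_tnth => i.
by rewrite tnth_mktuple (tnth_nth 0%N); case: i => [[|[|]]].
Qed.

(** Substitution of computable functions for the variables. *)
Lemma computable_subst f (gs : seq (seq nat -> nat)) :
  computable_fun f -> (forall g, List.In g gs -> computable_fun g) ->
  computable_fun (fun s => f [seq g s | g <- gs]).
Proof.
move=> cf cgs.
have cg (i : 'I_(size gs)) : computable_fun (nth (fun=> 0%N) gs i).
  apply: cgs; case: i => i /=; elim: gs i => //= g gs IH [|i] ilt; first by left.
  by right; apply: IH.
have := computable_total (cf _) cg; apply: eq_computable_fun => s; congr f.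
apply: (@eq_from_nth _ 0%N); rewrite ?size_tuple ?size_map // => i ilt.
by rewrite (nth_map (fun=> 0%N)) // nth_mktuple_ord.
Qed.

Lemma computable_app1 (h : nat -> nat) a :
  computable_fun (fun s => h (nth 0%N s 0)) -> computable_fun a ->
  computable_fun (fun s => h (a s)).
Proof.
by move=> ch ca; apply: (computable_subst (gs := [:: a]) ch) => g [<-|[]].
Qed.

Lemma computable_app2 (h : nat -> nat -> nat) a b :
  computable_fun (fun s => h (nth 0%N s 0) (nth 0%N s 1)) ->
  computable_fun a -> computable_fun b -> computable_fun (fun s => h (a s) (b s)).
Proof.
move=> ch ca cb.
by apply: (computable_subst (gs := [:: a; b]) ch) => g [<-|[<-|[]]].
Qed.

(** Weakening: a new variable may be put in front of the others. *)
Lemma computable_behead f :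
  computable_fun f -> computable_fun (fun s => f (behead s)).
Proof.
move=> cf [|k].
  have := cf 0%N; congr total_computable; apply/funext => x.
  by rewrite (tuple0 x).
have cp (i : 'I_k) : total_computable (fun x : k.+1.-tuple nat => nth 0%N x i.+1).
  exact: computable_var.
have := total_computable_comp (cf k) cp; congr total_computable.
apply/funext => x; congr f; apply: (@eq_from_nth _ 0%N).
  by rewrite !size_tuple.
move=> i; rewrite size_tuple => ik; rewrite nth_behead.
by rewrite nth_mktuple_ord.
Qed.

(** Primitive recursion; the step reads the counter and the accumulator in front
    of the other variables. *)
Lemma computable_iteri t f (g : nat -> nat -> seq nat -> nat) :
  computable_fun t -> computable_fun f ->
  computable_fun (fun s => g (nth 0%N s 0) (nth 0%N s 1) (behead (behead s))) ->
  computable_fun (fun s => iteri (t s) (fun i z => g i z s) (f s)).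
Proof.
move=> ct cf cg k; have := total_computable_primrec (cf k) (cg k.+2) => cp.
have ci (i : 'I_k.+1) : total_computable
    (fun x : k.-tuple nat => nth 0%N (t x :: x) i).
  by case: i => [[|i] _] /=; [exact: ct | exact: computable_var].
have := total_computable_comp cp ci; congr total_computable.
apply/funext => x; set u := mktuple _.
have uE : u = t x :: x :> seq nat.
  apply: (@eq_from_nth _ 0%N) => [|i]; rewrite size_tuple /= ?size_tuple // => ik.
  by rewrite nth_mktuple_ord.
have -> : thead u = t x by rewrite /thead (tnth_nth 0%N) uE.
by rewrite /= uE /=.
Qed.

Lemma computable_succ a : computable_fun a -> computable_fun (fun s => (a s).+1).
Proof.
move=> ca; apply: (computable_total1 PR_succ ca).
Qed.

Lemma computable_const n : computable_fun (fun=> n).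
Proof.
elim: n => [|n IHn]; last exact: computable_succ IHn.
by move=> k; apply: PR_zero.
Qed.

Lemma computable_pred a : computable_fun a -> computable_fun (fun s => (a s).-1).
Proof.
move=> ca.
have := computable_iteri (g := fun i _ _ => i) ca
  (computable_const 0) (computable_var 0).
by apply: eq_computable_fun => s; case: (a s).
Qed.

Lemma computable_add a b : computable_fun a -> computable_fun b ->
  computable_fun (fun s => a s + b s)%N.
Proof.
move=> ca cb.
have := computable_iteri (g := fun _ z _ => z.+1) cb ca
  (computable_succ (computable_var 1)).
by apply: eq_computable_fun => s; elim: (b s) => [|n /= ->]; rewrite ?addn0 ?addnS.
Qed.

Lemma computable_mul a b : computable_fun a -> computable_fun b ->
  computable_fun (fun s => a s * b s)%N.
Proof.
move=> ca cb.
have := computable_iteri (g := fun _ z s => z + a s)%N cb (computable_const 0)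
  (computable_add (computable_var 1) (computable_behead (computable_behead ca))).
by apply: eq_computable_fun => s; elim: (b s) => [|n /= ->]; rewrite ?muln0 ?mulnSr.
Qed.

Lemma computable_expn a b : computable_fun a -> computable_fun b ->
  computable_fun (fun s => a s ^ b s)%N.
Proof.
move=> ca cb.
have := computable_iteri (g := fun _ z s => z * a s)%N cb (computable_const 1)
  (computable_mul (computable_var 1) (computable_behead (computable_behead ca))).
by apply: eq_computable_fun => s; elim: (b s) => [|n /= ->]; rewrite ?expn0 ?expnSr.
Qed.

Lemma computable_sub a b : computable_fun a -> computable_fun b ->
  computable_fun (fun s => a s - b s)%N.
Proof.
move=> ca cb.
have := computable_iteri (g := fun _ z s => z.-1)%N cb ca
  (computable_pred (computable_var 1)).
by apply: eq_computable_fun => s; elim: (b s) => [|n /= ->]; rewrite ?subn0 ?subnS.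
Qed.

Lemma computable_leq a b : computable_fun a -> computable_fun b ->
  computable_fun (fun s => (a s <= b s)%N).
Proof.
move=> ca cb.
have := computable_sub (computable_const 1) (computable_sub ca cb).
by apply: eq_computable_fun => s; rewrite /leq; case: (a s - b s)%N.
Qed.

Lemma computable_neg (p : seq nat -> bool) :
  computable_fun p -> computable_fun (fun s => ~~ p s).
Proof.
move=> cp; have := computable_sub (computable_const 1) cp.
by apply: eq_computable_fun => s; case: (p s).
Qed.

Lemma computable_and (p q : seq nat -> bool) : computable_fun p ->
  computable_fun q -> computable_fun (fun s => p s && q s).
Proof.
move=> cp cq; have := computable_mul cp cq.
by apply: eq_computable_fun => s; rewrite mulnb.
Qed.

Lemma computable_or (p q : seq nat -> bool) : computable_fun p ->
  computable_fun q -> computable_fun (fun s => p s || q s).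
Proof.
move=> cp cq.
have := computable_neg (computable_and (computable_neg cp) (computable_neg cq)).
by apply: eq_computable_fun => s; rewrite negb_and !negbK.
Qed.

Lemma computable_imply (p q : seq nat -> bool) : computable_fun p ->
  computable_fun q -> computable_fun (fun s => p s ==> q s).
Proof.
move=> cp cq; have := computable_or (computable_neg cp) cq.
by apply: eq_computable_fun => s; rewrite implybE.
Qed.

Lemma computable_eq a b : computable_fun a -> computable_fun b ->
  computable_fun (fun s => a s == b s).
Proof.
move=> ca cb; have := computable_and (computable_leq ca cb) (computable_leq cb ca).
by apply: eq_computable_fun => s; rewrite -eqn_leq.
Qed.

Lemma computable_sum t (f : nat -> seq nat -> nat) : computable_fun t ->
  computable_fun (fun s => f (nth 0%N s 0) (behead s)) ->
  computable_fun (fun s => \sum_(0 <= i < t s) f i s)%N.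
Proof.
move=> ct cf.
have cg : computable_fun (fun s => nth 0%N s 1 + f (nth 0%N s 0) (behead (behead s)))%N.
  apply: computable_add (computable_var 1) _.
  (* Only the accumulator, the second variable, has to be forgotten. *)
  move=> k; case: k => [|[|k]].
  - by have := cf 0%N; congr total_computable; apply/funext => x; rewrite (tuple0 x).
  - have := cf 1%N; congr total_computable; apply/funext => x.
    by case: x => [[|i []]].
  have cv (i : 'I_k.+1) : total_computable
      (fun x : k.+2.-tuple nat => nth 0%N x (if i == 0%N :> nat then 0%N else i.+1)).
    exact: computable_var.
  have := total_computable_comp (cf k.+1) cv; congr total_computable.
  apply/funext => x; set u := mktuple _.
  suff -> : u = nth 0%N x 0 :: behead (behead x) :> seq nat by [].
  apply: (@eq_from_nth _ 0%N) => [|i];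
    rewrite size_tuple /= ?size_behead ?size_tuple // => ik.
  rewrite nth_mktuple_ord /=.
  by case: i ik => //= i _; rewrite !nth_behead.
have := computable_iteri (g := fun i z s => z + f i s)%N ct (computable_const 0) cg.
apply: eq_computable_fun => s; elim: (t s) => [|n /= ->]; first by rewrite big_geq.
by rewrite big_nat_recr.
Qed.

Lemma computable_all t (p : nat -> seq nat -> bool) : computable_fun t ->
  computable_fun (fun s => p (nth 0%N s 0) (behead s)) ->
  computable_fun (fun s => all (fun i => p i s) (iota 0 (t s))).
Proof.
move=> ct cp.
have := computable_eq (computable_sum (f := fun i s => ~~ p i s) ct (computable_neg cp))
  (computable_const 0).
apply: eq_computable_fun => s; congr nat_of_bool; rewrite /index_iota subn0.
elim: (iota _ _) => [|i r IHr]; first by rewrite big_nil.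
by rewrite big_cons addn_eq0 IHr /=; case: (p i s).
Qed.

Lemma sum_ltn m n : (\sum_(0 <= i < n) (i < m) = minn m n)%N.
Proof.
elim: n => [|n IHn]; first by rewrite big_geq // minn0.
by rewrite big_nat_recr //= IHn; case: (ltnP n m); lia.
Qed.

(** The quotient counts the positive multiples of the divisor up to the
    dividend. *)
Lemma computable_divn a b : computable_fun a -> computable_fun b ->
  computable_fun (fun s => a s %/ b s)%N.
Proof.
move=> ca cb.
have := computable_sum (f := fun i s => (0 < b s) && (i.+1 * b s <= a s))%N ca
  (computable_and (computable_leq (computable_const 1) (computable_behead cb))
  (computable_leq (computable_mul (computable_succ (computable_var 0))
    (computable_behead cb)) (computable_behead ca))).
apply: eq_computable_fun => s; have [->|b0] := posnP (b s).
  by rewrite divn0 big1.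
rewrite (eq_bigr (fun i => (i < a s %/ b s)%N : nat)) => [|i _].
  by rewrite sum_ltn; apply/minn_idPl; exact: leq_div.
by rewrite -leq_divRL.
Qed.

Lemma computable_modn a b : computable_fun a -> computable_fun b ->
  computable_fun (fun s => a s %% b s)%N.
Proof.
move=> ca cb; have := computable_sub ca (computable_mul (computable_divn ca cb) cb).
by apply: eq_computable_fun => s; rewrite {1}(divn_eq (a s) (b s)) addKn.
Qed.

Lemma computable_dvdn a b : computable_fun a -> computable_fun b ->
  computable_fun (fun s => a s %| b s)%N.
Proof.
by move=> ca cb; apply: computable_eq (computable_modn cb ca) (computable_const 0).
Qed.

Lemma computable_all_in (T : eqType) (r : seq T) (p : T -> seq nat -> bool) :
  (forall v, computable_fun (p v)) -> computable_fun (fun s => all (fun v => p v s) r).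
Proof.
move=> cp; elim: r => [|v r IHr]; first exact: computable_const.
exact: computable_and.
Qed.

Lemma computable_has_in (T : eqType) (r : seq T) (p : T -> seq nat -> bool) :
  (forall v, computable_fun (p v)) -> computable_fun (fun s => has (fun v => p v s) r).
Proof.
move=> cp; elim: r => [|v r IHr]; first exact: computable_const.
exact: computable_or.
Qed.

(** * The binary logarithm *)

Section BinaryLogarithm.
Context {R : realType}.
Implicit Types x y : R.
Local Open Scope ring_scope.

Lemma ln2_gt0 : 0 < ln 2 :> R.
Proof. by rewrite ln_gt0 // ltr1n. Qed.

Lemma log2M x y : 0 < x -> 0 < y -> log2 (x * y) = log2 x + log2 y.
Proof. by move=> x0 y0; rewrite /log2 lnM ?posrE // mulrDl. Qed.

Lemma log2_le x y : 0 < x -> x <= y -> log2 x <= log2 y.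
Proof.
move=> x0 xy; rewrite /log2 ler_pM2r ?invr_gt0 ?ln2_gt0 //.
by rewrite ler_ln ?posrE // (lt_le_trans x0).
Qed.

Lemma log2_ge0 x : 1 <= x -> 0 <= log2 x.
Proof. by move=> x1; apply: divr_ge0; [exact: ln_ge0 | exact: ltW ln2_gt0]. Qed.

Lemma log2X x n : 0 < x -> log2 (x ^+ n) = n%:R * log2 x.
Proof. by move=> x0; rewrite /log2 lnXn // -[ln x *+ n]mulr_natl mulrA. Qed.

Lemma log2_2 : log2 2 = 1 :> R.
Proof. by rewrite /log2 divff // gt_eqF // ln2_gt0. Qed.

Lemma log2_expn n : log2 (2 ^ n)%:R = n%:R :> R.
Proof. by rewrite natrX log2X // log2_2 mulr1. Qed.

Lemma log2_nat_ge1 n : (1 < n)%N -> 1 <= log2 n%:R :> R.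
Proof. by move=> n1; rewrite -[leLHS]log2_2 log2_le // ler_nat. Qed.

End BinaryLogarithm.

(** * Decoding words *)

(** The number of a list [x :: l] is [2 ^ x * (2 * m + 1)], where [m] is the
    number of [l]. The head is thus the 2-adic valuation, counted here as a
    bounded sum, which keeps it visibly computable. *)
Definition code_head (y : nat) : nat := \sum_(0 <= a < y) (2 ^ a.+1 %| y).

Definition code_tail (y : nat) : nat := y %/ 2 ^ (code_head y).+1.

Definition code_nth (y r : nat) : nat := code_head (iter r code_tail y).

Lemma code_head_cons x m : code_head (2 ^ x * m.*2.+1) = x.
Proof.
set y := (2 ^ x * _)%N.
have xy : (x < y)%N by rewrite (leq_trans (ltn_expl x (ltnSn 1))) // leq_pmulr.
rewrite /code_head (eq_bigr (fun a => (a < x)%N : nat)) => [|a _].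
  by rewrite sum_ltn; apply/minn_idPl/ltnW.
congr nat_of_bool; rewrite /y; have [ax|xa] := ltnP a x.
  by rewrite dvdn_mulr // dvdn_exp2l.
rewrite -(subnKC xa) -addnS expnD dvdn_pmul2l ?expn_gt0 //.
apply/negbTE/negP => /(dvdn_trans _) -/(_ 2%N).
by rewrite expnS dvdn_mulr // dvdn2 /= odd_double => /(_ isT).
Qed.

Lemma code_tail_cons x m : code_tail (2 ^ x * m.*2.+1) = m.
Proof.
rewrite /code_tail code_head_cons expnSr divnMA mulKn ?expn_gt0 //.
by rewrite divn2 /= uphalf_double.
Qed.

Lemma iter_code_tail s r : iter r code_tail (CodeSeq.code s) = CodeSeq.code (drop r s).
Proof.
elim: s r => [|x s IHs] [|r] //; last first.
  by rewrite iterSr [CodeSeq.code _]/= code_tail_cons IHs.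
by elim: r => [|r /= ->]; rewrite /= /code_tail div0n.
Qed.

Lemma code_nthE s r : code_nth (CodeSeq.code s) r = nth 0%N s r.
Proof.
rewrite /code_nth iter_code_tail -[r in RHS]addn0 -nth_drop.
case: drop => [|x s']; last exact: code_head_cons.
by rewrite /code_head big_geq.
Qed.

Lemma code_eq0 s : (CodeSeq.code s == 0%N) = (s == [::]).
Proof. by case: s => // x s /=; rewrite muln_eq0 expn_eq0. Qed.

Lemma iter_code_tail_eq0 s r :
  (iter r code_tail (CodeSeq.code s) == 0%N) = (size s <= r)%N.
Proof. by rewrite iter_code_tail code_eq0 -size_eq0 size_drop subn_eq0. Qed.

Lemma size_code s : (size s <= CodeSeq.code s)%N.
Proof.
elim: s => //= x s IHs; rewrite (leq_trans _ (leq_pmull _ _)) ?expn_gt0 //.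
by rewrite ltnS (leq_trans IHs) // -addnn leq_addr.
Qed.

Lemma computable_code_head : computable_fun (fun s => code_head (nth 0%N s 0)).
Proof.
apply: (computable_sum (f := fun a s => 2 ^ a.+1 %| nth 0%N s 0)) (computable_var 0) _.
apply: computable_dvdn (computable_behead (computable_var 0)).
exact: computable_expn (computable_const 2) (computable_succ (computable_var 0)).
Qed.

Lemma computable_iter_code_tail a b : computable_fun a -> computable_fun b ->
  computable_fun (fun s => iter (a s) code_tail (b s)).
Proof.
move=> ca cb.
have := computable_iteri (g := fun _ z _ => code_tail z) ca cb.
have /[swap]/[apply] : computable_fun (fun s => code_tail (nth 0%N s 1)).
  apply: (computable_app1 (h := code_tail)) (computable_var 1).
  apply: computable_divn (computable_var 0) _.
  exact: computable_expn (computable_const 2) (computable_succ computable_code_head).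
by apply: eq_computable_fun => s; elim: (a s) => //= n ->.
Qed.

Lemma computable_code_nth a b : computable_fun a -> computable_fun b ->
  computable_fun (fun s => code_nth (a s) (b s)).
Proof.
move=> ca cb; apply: (computable_app1 computable_code_head).
exact: computable_iter_code_tail.
Qed.

(** The number with binary digits [c_0 c_1 ...], least significant first, when
    [c] is the number of a binary word. Summing up to [c] instead of the length
    is harmless, as the length is at most [c] and further symbols read as 0. *)
Definition word_value (c : nat) : nat := \sum_(0 <= r < c) code_nth c r * 2 ^ r.

Lemma computable_word_value a :
  computable_fun a -> computable_fun (fun s => word_value (a s)).
Proof.
apply: computable_app1; apply: (computable_sum
  (f := fun r s => code_nth (nth 0%N s 0) r * 2 ^ r)%N) (computable_var 0) _.
apply: computable_mul; last first.
  exact: computable_expn (computable_const 2) (computable_var 0).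
exact: computable_code_nth (computable_behead (computable_var 0)) (computable_var 0).
Qed.

Definition binary_word (N : nat) : seq bool :=
  mkseq (fun r => odd (N %/ 2 ^ r)) (trunc_log 2 N).+1.

Lemma sum_binary_digits N s :
  (\sum_(0 <= r < s) odd (N %/ 2 ^ r) * 2 ^ r = N %% 2 ^ s)%N.
Proof.
elim: s => [|s IHs]; first by rewrite big_geq // modn1.
rewrite big_nat_recr //= IHs.
set q := (N %/ 2 ^ s)%N; set r := (N %% 2 ^ s)%N.
have rs : (r < 2 ^ s)%N by rewrite ltn_mod expn_gt0.
have -> : N = (q./2 * 2 ^ s.+1 + (r + odd q * 2 ^ s))%N.
  rewrite {1}(divn_eq N (2 ^ s)) -/q -/r -{1}(odd_double_half q) expnS.
  by move: (2 ^ s)%N (odd q : nat) => X b; lia.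
rewrite modnMDl modn_small // expnS.
by case: (odd q); move: rs; clearbody r; lia.
Qed.

Lemma word_value_binary_word N :
  word_value (choice.pickle (binary_word N)) = N.
Proof.
rewrite /word_value; set p := binary_word N; set c := choice.pickle p.
have cE : c = CodeSeq.code (map nat_of_bool p) by [].
have pc : (size p <= c)%N by rewrite cE -(size_map nat_of_bool) size_code.
transitivity (\sum_(0 <= r < size p) code_nth c r * 2 ^ r)%N.
  rewrite (@big_cat_nat _ _ _ (size p)) //; apply: etrans (addn0 _).
  congr (_ + _)%N; rewrite big_nat_cond big1 // => r /andP[/andP[pr _] _].
  by rewrite cE code_nthE [nth _ _ _]nth_default ?mul0n // [leqLHS]size_map.
rewrite -[RHS](@modn_small _ (2 ^ size p)); last first.
  by rewrite size_mkseq trunc_log_ltn.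
rewrite -sum_binary_digits; apply: eq_big_nat => r /andP[_ rp].
rewrite cE code_nthE (nth_map false) // nth_mkseq //.
by move: rp; rewrite size_mkseq.
Qed.

Lemma expn2_size_binary_word N : (0 < N)%N -> (2 ^ size (binary_word N) <= 2 * N)%N.
Proof. by move=> N0; rewrite size_mkseq expnS leq_mul2l /= trunc_logP. Qed.

(** A pairing whose length is that of [m] plus twice that of [n]: the [a] low
    zeros announce the number of digits of [n], and the digits of [n] and then of
    [m] follow. The usual quadratic pairing would double the length of [m],
    which is the main term. *)
Definition encode_pair (n m : nat) : nat :=
  let a := (trunc_log 2 n).+1 in 2 ^ a * (n + 2 ^ a * m).*2.+1.

Definition decode_fst (N : nat) : nat := code_tail N %% 2 ^ code_head N.

Definition decode_snd (N : nat) : nat := code_tail N %/ 2 ^ code_head N.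

Lemma encode_pairK1 n m : decode_fst (encode_pair n m) = n.
Proof.
rewrite /decode_fst code_head_cons code_tail_cons addnC mulnC modnMDl.
by rewrite modn_small // trunc_log_ltn.
Qed.

Lemma encode_pairK2 n m : decode_snd (encode_pair n m) = m.
Proof.
rewrite /decode_snd code_head_cons code_tail_cons addnC mulnC divnMDl ?expn_gt0 //.
by rewrite divn_small ?addn0 // trunc_log_ltn.
Qed.

Lemma encode_pair_le n m : (0 < n)%N -> (encode_pair n m <= 8 * n ^ 2 * m.+1)%N.
Proof.
move=> n0; rewrite /encode_pair; set t := trunc_log 2 n.
have tn : (2 ^ t <= n)%N by rewrite trunc_logP.
have nt : (n < 2 ^ t.+1)%N by rewrite trunc_log_ltn.
have tn' : (2 ^ t.+1 <= 2 * n)%N by rewrite expnS leq_mul2l.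
apply: (@leq_trans (2 ^ t.+1 * (2 * 2 ^ t.+1 * m.+1))).
  by rewrite leq_mul2l; apply/orP; right; lia.
have := leq_mul tn' tn'; nia.
Qed.

Lemma computable_decode_fst a :
  computable_fun a -> computable_fun (fun s => decode_fst (a s)).
Proof.
apply: computable_app1; apply: computable_modn.
  exact: (computable_iter_code_tail (computable_const 1) (computable_var 0)).
exact: computable_expn (computable_const 2) computable_code_head.
Qed.

Lemma computable_decode_snd a :
  computable_fun a -> computable_fun (fun s => decode_snd (a s)).
Proof.
apply: computable_app1; apply: computable_divn.
  exact: (computable_iter_code_tail (computable_const 1) (computable_var 0)).
exact: computable_expn (computable_const 2) computable_code_head.
Qed.

(** * Words in a computable family of finite sets *)

Section ComputableFamily.
Variables (R : realType) (L : finType) (D : nat -> seq (seq L)).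

Hypothesis computableD : computable_fun (fun s =>
  (0 < nth 0%N s 0)%N && (nth 0%N s 1 \in map choice.pickle (D (nth 0%N s 0)))).

Let S n y := (0 < n)%N && (y \in map choice.pickle (D n)).

(* The position of the number y in the increasing list of those of D n. *)
Let position n y := (\sum_(0 <= i < y) S n i)%N.

Let computableS a b : computable_fun a -> computable_fun b ->
  computable_fun (fun s => S (a s) (b s)).
Proof. exact: (computable_app2 (h := fun a b => S a b)). Qed.

Let position_lt n y : S n y -> (position n y < size (D n))%N.
Proof.
move=> Sy; have -> : position n y = size [seq i <- iota 0 y | S n i].
  rewrite size_filter -sum1_count big_mkcond /= /position /index_iota subn0.
  by apply: eq_bigr => i _; case: S.
rewrite -(size_map choice.pickle (D n)).
have <- : size [seq i <- iota 0 y.+1 | S n i] = (size [seq i <- iota 0 y | S n i]).+1.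
  by rewrite -addn1 iotaD filter_cat size_cat /= add0n Sy addn1.
apply: uniq_leq_size => [|i]; first by rewrite filter_uniq ?iota_uniq.
by rewrite mem_filter => /andP[/andP[]].
Qed.

Let position_inj n y z : S n y -> S n z -> position n y = position n z -> y = z.
Proof.
wlog yz : y z / (y <= z)%N => [IH Sy Sz e|Sy Sz].
  by have [/IH|/ltnW/IH] := leqP y z; [apply | move=> e'; apply/esym/e'].
move: yz; rewrite leq_eqVlt => /predU1P[//|yz].
rewrite /position (@big_cat_nat _ _ _ y 0%N z) //=; last exact: ltnW.
by rewrite [X in (_ + X)%N]big_ltn // Sy => e; lia.
Qed.

(* The program numbered c encodes a pair (n, m), and outputs the word whose
   number y is the m-th one of D n. *)
Let Q c y := let N := word_value c in
  S (decode_fst N) y && (position (decode_fst N) y == decode_snd N).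

Let Q_inj c y z : Q c y -> Q c z -> y = z.
Proof.
move=> /andP[Sy /eqP py] /andP[Sz /eqP pz].
by apply: position_inj Sy Sz _; rewrite py.
Qed.

Let decompress (p : seq bool) : option (seq L) :=
  match pselect (exists w : seq L, Q (choice.pickle p) (choice.pickle w)) with
  | left h => Some (projT1 (cid h))
  | right _ => None
  end.

(* Searching for the least such y is a partial recursive procedure; it finds the
   only one, if there is any. *)
Let decompressor_decompress : decompressor decompress.
Proof.
exists (mu_graph (fun (z : 2.-tuple nat) v => v = ~~ Q (nth 0%N z 1) (nth 0%N z 0))).
  apply: PR_mu.
  suff : computable_fun (fun s => ~~ Q (nth 0%N s 1) (nth 0%N s 0)) by exact.
  have cN := computable_word_value (computable_var 1).
  have cp : computable_fun (fun s => position (nth 0%N s 0) (nth 0%N s 1)).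
    apply: (computable_sum (f := fun i s => S (nth 0%N s 0) i)) (computable_var 1) _.
    exact: computableS (computable_behead (computable_var 0)) (computable_var 0).
  apply/computable_neg/computable_and.
    exact: computableS (computable_decode_fst cN) (computable_var 0).
  apply: computable_eq (computable_decode_snd cN).
  exact: (computable_app2 (h := position) cp (computable_decode_fst cN)
    (computable_var 0)).
move=> p y; transitivity (Q (choice.pickle p) y).
  split=> [[/= ]|Qy]; first by case: (Q _ _).
  split=> /= [|i iy]; first by rewrite Qy.
  exists 0%N; case: (boolP (Q _ i)) => // Qi.
  by rewrite (Q_inj Qi Qy) ltnn in iy.
rewrite /decompress; case: pselect => [h|nh] /=.
  case: (cid h) => w Qw /=; split=> [Qy|[<-]//].
  by rewrite (Q_inj Qy Qw).
split=> // Qy; case: nh; have /andP[/andP[_ /mapP[w _ yE]] _] := Qy.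
by exists w; rewrite -yE.
Qed.

(** A word of [D n] is described by [n] and by its position, which is less than
    [size (D n)]. *)
Lemma complexity_computable_family (A : seq bool -> option (seq L)) :
  optimal_decompressor R A ->
  exists c : R, forall n w, (0 < n)%N -> w \in D n ->
    (K0 R A w <= (2 * log2 n%:R + log2 (size (D n))%:R + c)%:E)%E.
Proof.
move=> [_ /(_ _ decompressor_decompress)[c Kc]]; exists (4 + c)%R => n w n0 wD.
apply: (le_trans (Kc w)).
pose y := choice.pickle w; have Sy : S n y by rewrite /S n0 map_f.
pose p := binary_word (encode_pair n (position n y)).
have pw : decompress p = Some w.
  rewrite /decompress; have Qy : Q (choice.pickle p) y.
    by rewrite /Q word_value_binary_word encode_pairK1 encode_pairK2 Sy /=.
  case: pselect => [h|nh]; last by case: nh; exists w.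
  case: cid => v Qv /=; congr Some; apply: (pcan_inj choice.pickleK).
  exact: Q_inj Qv Qy.
have size_p : (2 ^ size p <= 2 ^ 4 * (n * n * size (D n)))%N.
  (* 2 from rounding up to whole digits, 8 from the pairing *)
  apply: (leq_trans (expn2_size_binary_word _)).
    by rewrite muln_gt0 expn_gt0.
  have := encode_pair_le (position n y) n0; have := position_lt Sy.
  move: (position n y) (size (D n)) => m M mM.
  have : (n * n * m.+1 <= n * n * M)%N by rewrite leq_mul2l mM orbT.
  by lia.
have D0 : (0 < size (D n))%N by case: (D n) wD.
have K_p : (K0 R decompress w <= (size p)%:R%:E)%E.
  by apply: ereal_inf_lbound; exists p.
apply: (le_trans (leeD K_p (lexx _))); rewrite -EFinD lee_fin.
rewrite addrA lerD2r.
have /log2_le : (0 < (2 ^ size p)%:R :> R)%R by rewrite ltr0n expn_gt0.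
move=> /(_ (2 ^ 4 * (n * n * size (D n)))%:R%R); rewrite ler_nat => /(_ size_p).
rewrite log2_expn [(_ * (_ * _))%:R%R]natrM log2M ?ltr0n ?muln_gt0 ?n0 ?D0 //.
rewrite log2_expn !natrM !log2M ?mulr_gt0 ?ltr0n //.
by lra.
Qed.

End ComputableFamily.

(** * Finite sets of group elements as numbers *)

Definition bit (c b : nat) : bool := odd (c %/ 2 ^ b).

(** When [c] codes a finite set by its binary digits, this is the position of
    [b] in the increasing list of its elements. *)
Definition rank (c b : nat) : nat := \sum_(0 <= i < b) bit c i.

Lemma bit_sum_digits (d : nat -> bool) m b :
  bit (\sum_(0 <= i < m) d i * 2 ^ i) b = (b < m)%N && d b.
Proof.
have lt_sum n : (\sum_(0 <= i < n) d i * 2 ^ i < 2 ^ n)%N.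
  elim: n => [|n IHn]; first by rewrite big_geq.
  by rewrite big_nat_recr //= expnS; case: (d n); lia.
rewrite /bit; elim: m => [|m IHm]; first by rewrite big_geq // div0n.
have [bm|mb|->] := ltngtP b m.
- rewrite big_nat_recr //= divnDr; last by rewrite dvdn_mull // dvdn_exp2l // ltnW.
  rewrite oddD IHm bm ltnS (ltnW bm) /= -(subnK (ltnW bm)) expnD mulnA.
  rewrite mulnK ?expn_gt0 //.
  by rewrite oddM oddX subn_eq0 leqNgt bm andbF addbF.
- rewrite ltnS leqNgt mb /= divn_small //; apply: leq_trans (lt_sum _) _.
  by rewrite leq_exp2l.
- rewrite ltnSn big_nat_recr //= divnDr ?dvdn_mull // divn_small // add0n.
  by rewrite mulnK ?expn_gt0 // oddb.
Qed.

Lemma bit_sum_expn (s : seq nat) b : uniq s -> bit (\sum_(a <- s) 2 ^ a) b = (b \in s).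
Proof.
move=> us; pose m := (\max_(a <- s) a.+1)%N.
have sm a : a \in s -> (a < m)%N.
  by move=> sa; exact: (@leq_bigmax_seq _ s xpredT (fun a => a.+1) a sa isT).
have -> : (\sum_(a <- s) 2 ^ a = \sum_(0 <= i < m) (i \in s) * 2 ^ i)%N.
  rewrite [RHS](eq_bigr (fun i => if i \in s then 2 ^ i else 0)%N); last first.
    by move=> i _; case: (i \in s); rewrite ?mul1n.
  rewrite -big_mkcond -[RHS]big_filter; apply: perm_big; apply: uniq_perm => //.
    by rewrite filter_uniq ?iota_uniq.
  move=> i; rewrite mem_filter mem_index_iota /=.
  by case: (boolP (i \in s)) => //= /sm ->.
by rewrite bit_sum_digits; case: (boolP (b \in s)) => [/sm ->|]; rewrite ?andbF.
Qed.

Lemma bit_lt c b : bit c b -> (b < c)%N.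
Proof.
rewrite /bit; have [//|cb] := ltnP b c; rewrite divn_small //.
exact: leq_ltn_trans cb (ltn_expl _ _).
Qed.

Lemma rank_count c b : rank c b = count (bit c) (iota 0 b).
Proof.
rewrite -sum1_count big_mkcond /rank /index_iota subn0.
by apply: eq_bigr => i _; case: bit.
Qed.

Lemma index_filter_iota (p : pred nat) c b : p b -> (b < c)%N ->
  index b [seq i <- iota 0 c | p i] = count p (iota 0 b).
Proof.
move=> pb bc; rewrite -(subnKC bc) -addn1 -addnA iotaD filter_cat index_cat.
rewrite mem_filter mem_iota add0n ltnn andbF.
by rewrite /= pb /= eqxx addn0 size_filter.
Qed.

Lemma computable_bit a b : computable_fun a -> computable_fun b ->
  computable_fun (fun s => bit (a s) (b s)).
Proof.
move=> ca cb.
have := computable_modn (computable_divn ca (computable_expn (computable_const 2) cb))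
  (computable_const 2).
by apply: eq_computable_fun => s; rewrite modn2.
Qed.

Lemma computable_rank a b : computable_fun a -> computable_fun b ->
  computable_fun (fun s => rank (a s) (b s)).
Proof.
move=> ca cb; apply: computable_app2 ca cb.
apply: (computable_sum (f := fun i s => bit (nth 0%N s 0) i)) (computable_var 1) _.
exact: computable_bit (computable_behead (computable_var 0)) (computable_var 0).
Qed.

Section FiniteWords.
Variables (G : groupType) (L : finType) (l0 : L).
Implicit Types (U T : {fset G}) (v : G -> L).

Definition restrict U v : {ffun U -> L} := [ffun u => v (val u)].

Definition extend U (w : {ffun U -> L}) : G -> L := fun x => oapp w l0 (insub x).

Lemma extendE U (w : {ffun U -> L}) (u : U) : extend w (val u) = w u.
Proof. by rewrite /extend valK. Qed.

Lemma extend_restrict U v x : x \in U -> extend (restrict U v) x = v x.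
Proof. by move=> xU; rewrite -[x]/(val [` xU]%fset) extendE ffunE. Qed.

Definition tiled_at U T (Z : set G) (z : G) : bool :=
  `[< Z z >] && [forall t : T, (val t * z)%g \in U].

Definition tile_word T v (z : G) : {ffun T -> L} := [ffun t : T => v (val t * z)%g].

(** The centers range over [U] only; when the tile contains the identity, each
    translate inside [U] has its center there. *)
Definition tiled_words T (Z : set G) (W : {set {ffun T -> L}}) U :
    {set {ffun U -> L}} :=
  [set w : {ffun U -> L} | [forall z : U,
     tiled_at U T Z (val z) ==> (tile_word T (extend w) (val z) \in W)]]%SET.

Variable idx : G -> nat.
Hypothesis idx_inj : injective idx.

Definition index_code U : nat := \sum_(x <- U) 2 ^ idx x.

Lemma bit_index_code U x : bit (index_code U) (idx x) = (x \in U).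
Proof.
rewrite /index_code -(big_map idx xpredT (fun a => 2 ^ a)%N) bit_sum_expn.
  by rewrite mem_map.
by rewrite map_inj_uniq // fset_uniq.
Qed.

Lemma bit_index_codeP U a :
  reflect (exists2 x, x \in U & a = idx x) (bit (index_code U) a).
Proof.
rewrite /index_code -(big_map idx xpredT (fun a => 2 ^ a)%N) bit_sum_expn.
  exact: mapP.
by rewrite map_inj_uniq // fset_uniq.
Qed.

Definition indexed_enum U : seq U :=
  sort (fun u v : U => (idx (val u) <= idx (val v))%N) (enum {: U}).

(** Listing [U] by increasing index amounts to scanning the binary digits of its
    code. *)
Lemma indexed_enumE U :
  map (idx \o val) (indexed_enum U) =
  [seq b <- iota 0 (index_code U) | bit (index_code U) b].
Proof.
have injv : injective (idx \o (val : U -> G)) by apply: inj_comp idx_inj val_inj.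
apply: (irr_sorted_eq ltn_trans ltnn).
- rewrite ltn_sorted_uniq_leq map_inj_uniq // sort_uniq enum_uniq /=.
  rewrite sorted_map; apply: sort_sorted => u u' /=; exact: leq_total.
- apply: sorted_filter; [exact: ltn_trans | exact: iota_ltn_sorted].
move=> a; rewrite mem_filter mem_iota add0n /=.
apply/mapP/andP => [[u _ ->] /=|[/bit_index_codeP[x xU ->] _]].
  by rewrite bit_index_code (valP u) bit_lt // bit_index_code (valP u).
by exists [` xU]%fset; rewrite ?mem_sort ?mem_enum.
Qed.

Lemma size_indexed_enum U :
  size (indexed_enum U) = rank (index_code U) (index_code U).
Proof. by rewrite -(size_map (idx \o val)) indexed_enumE size_filter rank_count. Qed.

Lemma index_indexed_enum U (u : U) :
  index u (indexed_enum U) = rank (index_code U) (idx (val u)).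
Proof.
have injv : injective (idx \o (val : U -> G)) by apply: inj_comp idx_inj val_inj.
rewrite -(index_map injv) indexed_enumE rank_count index_filter_iota //=.
  by rewrite bit_index_code (valP u).
by rewrite bit_lt // bit_index_code (valP u).
Qed.

Lemma mem_indexed_enum U (u : U) : u \in indexed_enum U.
Proof. by rewrite mem_sort mem_enum. Qed.

(** Reading a symbol of a word on [U] off the number of the word only takes the
    code of [U] and the index of the position. *)
Lemma code_nth_section_word U (w : {ffun U -> L}) x : x \in U ->
  code_nth (choice.pickle (section_word idx w)) (rank (index_code U) (idx x)) =
  choice.pickle (extend w x).
Proof.
move=> xU; rewrite -[x]/(val [` xU]%fset) extendE -index_indexed_enum.
set u := [` xU]%fset.
rewrite [choice.pickle _]/(CodeSeq.code (map choice.pickle (section_word idx w))).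
rewrite code_nthE -map_comp (nth_map u) ?index_mem ?mem_indexed_enum //=.
by rewrite nth_index ?mem_indexed_enum.
Qed.

Lemma section_word_inj U : injective (@section_word L G idx U).
Proof.
move=> w w' /eq_in_map e; apply/ffunP => u; apply: e; exact: mem_indexed_enum.
Qed.

(** Here [c] is the code of a set, whose cardinality is [rank c c]; the two
    conditions bound the length of the list numbered [y] from above and from
    below, and require that its entries number symbols. *)
Definition is_section_code (c y : nat) : bool :=
  (iter (rank c c) code_tail y == 0%N) &&
  all (fun r => (iter r code_tail y != 0%N) &&
         has (fun l : L => code_nth y r == choice.pickle l) (enum L))
    (iota 0 (rank c c)).

Lemma is_section_codeP U y :
  reflect (exists w : {ffun U -> L}, y = choice.pickle (section_word idx w))
          (is_section_code (index_code U) y).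
Proof.
rewrite /is_section_code -size_indexed_enum.
apply: (iffP andP) => [[y0 /allP yL]|[w ->]]; last first.
  rewrite [choice.pickle _]/(CodeSeq.code (map choice.pickle (section_word idx w))).
  rewrite iter_code_tail_eq0 !size_map leqnn; split=> //.
  apply/allP => r; rewrite mem_iota add0n iter_code_tail_eq0 !size_map -ltnNge.
  move=> /= rs; rewrite rs /=; apply/hasP; exists (nth l0 (section_word idx w) r).
    by rewrite mem_enum.
  by rewrite code_nthE (nth_map l0) ?size_map.
move: y0 yL; rewrite -(CodeSeq.decodeK y); set s := CodeSeq.decode y.
rewrite iter_code_tail_eq0 => sle yL.
have ssize : size s = size (indexed_enum U).
  apply/eqP; rewrite eqn_leq sle /=; case e: (size _) => [//|m].
  have /yL/andP[+ _] : m \in iota 0 (size (indexed_enum U)).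
    by rewrite mem_iota add0n e /=.
  by rewrite iter_code_tail_eq0 -ltnNge.
pose sym r := odflt l0 [pick l : L | nth 0%N s r == choice.pickle l].
have symE r : (r < size s)%N -> choice.pickle (sym r) = nth 0%N s r.
  rewrite ssize => rs.
  have /yL/andP[_ /hasP[l _]] : r \in iota 0 (size (indexed_enum U)).
    by rewrite mem_iota add0n.
  rewrite code_nthE => el; rewrite /sym; case: pickP => /= [l' /eqP ->//|/(_ l)].
  by rewrite el.
exists [ffun u => sym (index u (indexed_enum U))].
rewrite [choice.pickle _]/(CodeSeq.code (map choice.pickle (section_word idx _))).
congr CodeSeq.code; apply: (@eq_from_nth _ 0%N); rewrite ?size_map // => r rs.
have rt : (r < size (indexed_enum U))%N by rewrite -ssize.
have u0 : U by case: (indexed_enum U) rt => // u0.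
rewrite -map_comp (nth_map u0) //= ffunE index_uniq ?symE //.
by rewrite sort_uniq enum_uniq.
Qed.

End FiniteWords.

(** * Complexity of tiled words *)

Section TiledWords.
Variables (R : realType) (G : groupType) (L : finType) (l0 : L) (idx : G -> nat).
Variables (F : nat -> {fset G}) (T : {fset G}) (Z : set G).
Variable W : {set {ffun T -> L}}.
Variables (indexF inZ : nat -> nat) (mulG : nat -> nat -> nat).

Hypothesis idx_inj : injective idx.
Hypothesis indexFE : forall n, (0 < n)%N -> indexF n = index_code idx (F n).
Hypothesis inZE : forall x, inZ (idx x) = (x \in Z).
Hypothesis mulGE : forall x y, mulG (idx x) (idx y) = idx (x * y)%g.

Hypothesis computable_indexF : computable_fun (fun s => indexF (nth 0%N s 0)).
Hypothesis computable_inZ : computable_fun (fun s => inZ (nth 0%N s 0)).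
Hypothesis computable_mulG :
  computable_fun (fun s => mulG (nth 0%N s 0) (nth 0%N s 1)).

(* Membership in tiled_words, read off the code c of the set and the number y of
   the word; a runs over the indices of the possible centers. The tile and the
   words allowed on it enter as finite constants. *)
Let is_tiled_code (c y : nat) : bool :=
  all (fun a => bit c a && (0 < inZ a)%N &&
         all (fun t : T => bit c (mulG (idx (val t)) a)) (enum {: T}) ==>
         has (fun v : {ffun T -> L} =>
           all (fun t : T => code_nth y (rank c (mulG (idx (val t)) a)) ==
                             choice.pickle (v t)) (enum {: T})) (enum W))
    (iota 0 c).

Let is_tiled_codeP (U : {fset G}) (w : {ffun U -> L}) :
  is_tiled_code (index_code idx U) (choice.pickle (section_word idx w)) =
  (w \in tiled_words l0 Z W U).
Proof.
set c := index_code idx U; rewrite inE.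
have tiledE z : z \in U ->
    bit c (idx z) && (0 < inZ (idx z))%N &&
      all (fun t : T => bit c (mulG (idx (val t)) (idx z))) (enum {: T}) =
    tiled_at U T Z z.
  move=> zU; rewrite bit_index_code // zU inZE /tiled_at; congr andb.
    by rewrite lt0b.
  apply/allP/forallP => h t.
    by have := h t; rewrite mem_enum mulGE bit_index_code //; apply.
  by rewrite mulGE bit_index_code.
have wordE z : tiled_at U T Z z ->
    has (fun v : {ffun T -> L} =>
      all (fun t : T => code_nth (choice.pickle (section_word idx w))
             (rank c (mulG (idx (val t)) (idx z))) == choice.pickle (v t))
          (enum {: T})) (enum W) =
    (tile_word T (extend l0 w) z \in W).
  move=> /andP[_ /forallP tzU]; apply/hasP/idP => [[v vW /allP hv]|wW].
    suff -> : tile_word T (extend l0 w) z = v by rewrite mem_enum in vW.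
    apply/ffunP => t; rewrite ffunE; apply: (pcan_inj choice.pickleK).
    have /eqP <- := hv t (mem_enum _ _).
    by rewrite mulGE (code_nth_section_word l0).
  exists (tile_word T (extend l0 w) z); first by rewrite mem_enum.
  apply/allP => t _; rewrite mulGE (code_nth_section_word l0) ?ffunE //.
apply/allP/forallP => [h z|h a _].
  have /h : idx (val z) \in iota 0 c.
    by rewrite mem_iota add0n /= bit_lt // bit_index_code // (valP z).
  rewrite tiledE ?(valP z) //; case: (boolP (tiled_at _ _ _ _)) => // tz.
  by rewrite wordE.
have [/bit_index_codeP -/(_ idx_inj)[x xU ->]|] := boolP (bit c a); last by [].
have := h [` xU]%fset; rewrite -tiledE //= bit_index_code // xU /=.
case: (boolP (_ && _)) => //= tx; rewrite wordE //.
by rewrite -tiledE // bit_index_code // xU.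
Qed.

(** Since [W] is a fixed finite set, the words tiled by it are decidable even if
    they come from a subshift that is not. *)
Lemma complexity_tiled_words (A : seq bool -> option (seq L)) :
  optimal_decompressor R A ->
  exists c : R, forall n w, (0 < n)%N -> w \in tiled_words l0 Z W (F n) ->
    (K0 R A (section_word idx w) <=
      (2 * log2 n%:R + log2 (#|tiled_words l0 Z W (F n)|)%:R + c)%:E)%E.
Proof.
move=> optA; pose D n := [seq section_word idx w | w in tiled_words l0 Z W (F n)].
have [|b Kb] := @complexity_computable_family R L D _ A optA; last first.
  exists b => n w n0 wD; have := Kb n (section_word idx w) n0.
  by rewrite size_map -cardE; apply; apply: map_f; rewrite mem_enum.
pose c s := indexF (nth 0%N s 0).
have cc : computable_fun c by [].
apply: (@eq_computable_fun (fun s => (0 < nth 0%N s 0)%N &&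
    (is_section_code L (c s) (nth 0%N s 1) && is_tiled_code (c s) (nth 0%N s 1)))).
  move=> s; congr nat_of_bool; have [//|n0] := posnP; rewrite /c indexFE //=.
  move: (nth 0%N s 0) n0 (nth 0%N s 1) => n n0 y.
  apply/andP/mapP => [[/(is_section_codeP l0 idx_inj)[w ->]]|].
    rewrite is_tiled_codeP => wW; exists (section_word idx w) => //.
    by apply: map_f; rewrite mem_enum.
  move=> [_ /mapP[w wW ->] ->]; rewrite is_tiled_codeP.
  split; last by rewrite -mem_enum.
  by apply/(is_section_codeP l0 idx_inj); exists w.
have cy : computable_fun (nth 0%N ^~ 1%N) by exact: computable_var.
apply: computable_and (computable_leq (computable_const 1) (computable_var 0)) _.
apply: computable_and.
  apply: computable_and.
    apply: computable_eq (computable_const 0).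
    exact: computable_iter_code_tail (computable_rank cc cc) cy.
  apply: (computable_all (p := fun r s => (iter r code_tail (nth 0%N s 1) != 0%N) &&
     has (fun l : L => code_nth (nth 0%N s 1) r == choice.pickle l) (enum L)))
     (computable_rank cc cc) _.
  apply: computable_and.
    apply/computable_neg/computable_eq/computable_const.
    exact: computable_iter_code_tail (computable_var 0) (computable_behead cy).
  apply: computable_has_in => l.
  apply: computable_eq (computable_const _).
  exact: computable_code_nth (computable_behead cy) (computable_var 0).
rewrite /is_tiled_code.
apply: (computable_all (p := fun a s => bit (c s) a && (0 < inZ a)%N &&
         all (fun t : T => bit (c s) (mulG (idx (val t)) a)) (enum {: T}) ==>
         has (fun v : {ffun T -> L} =>
           all (fun t : T =>
             code_nth (nth 0%N s 1) (rank (c s) (mulG (idx (val t)) a)) ==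
             choice.pickle (v t)) (enum {: T})) (enum W)) cc).
have cc' := computable_behead cc.
have cm t : computable_fun (fun s => mulG (idx t) (nth 0%N s 0)).
  exact: (computable_app2 computable_mulG (computable_const _) (computable_var 0)).
apply: computable_imply.
  apply: computable_and.
    apply: computable_and (computable_bit cc' (computable_var 0)) _.
    exact: computable_leq (computable_const 1) computable_inZ.
  by apply: computable_all_in => t; exact: computable_bit.
apply: computable_has_in => v.
apply: computable_all_in => t.
apply: computable_eq (computable_const _).
apply: computable_code_nth (computable_behead cy) _.
exact: computable_rank.
Qed.

End TiledWords.

(** * Counting tiled words *)

Lemma boundary_finite (G : groupType) (K U : {fset G}) :
  finite_set (boundary [set` K] [set` U]).
Proof.
apply: sub_finite_set (finite_fset [fset (k^-1 * f)%g | k in K, f in U]%fset).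
by move=> _ [[k kK [f fU <-]] _] /=; apply: in_imfset2.
Qed.

Lemma size_preim_fset (G : choiceType) (U : {fset G}) (A : {set U}) (s : seq G) :
  (forall u, u \in A -> val u \in s) -> (#|A| <= size s)%N.
Proof.
move=> As; rewrite cardE -(size_map val); apply: uniq_leq_size.
  by rewrite (map_inj_uniq val_inj) enum_uniq.
by move=> _ /mapP[u uA ->]; apply: As; rewrite mem_enum in uA.
Qed.

Section TilingCount.
Variables (G : groupType) (L : finType) (l0 : L).
Variables (U T : {fset G}) (Z : set G) (W : {set {ffun T -> L}}).

Let C : {set U} := [set z : U | tiled_at U T Z (val z)]%SET.

Let rest : {set U} :=
  [set u : U | [forall z in C, forall t : T, val u != (val t * val z)%g]]%SET.

(** A tiled word is determined by its words on the translates inside [U] and by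
    its symbols at the positions outside all of them. *)
Lemma card_tiled_words :
  (#|tiled_words l0 Z W U| <= #|W| ^ #|C| * #|L| ^ #|rest|)%N.
Proof.
pose w0 : {ffun T -> L} := [ffun=> l0].
pose enc (w : {ffun U -> L}) :=
  ([ffun z : U => if z \in C then tile_word T (extend l0 w) (val z) else w0],
   [ffun u : U => if u \in rest then w u else l0]).
have enc_inj : injective enc.
  move=> w w' [/ffunP eC /ffunP eR]; apply/ffunP => u.
  case: (boolP (u \in rest)) => [uR|]; first by have := eR u; rewrite !ffunE uR.
  rewrite inE negb_forall => /existsP[z]; rewrite negb_imply negb_forall.
  move=> /andP[zC /existsP[t /negPn/eqP ut]].
  have := eC z; rewrite !ffunE zC => /ffunP/(_ t); rewrite !ffunE -ut.
  by rewrite !extendE.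
(* The first component takes the constant value w0 off the centers, and the
   second one the value l0 off rest; so each ranges over a set of partial
   functions. *)
rewrite -(card_imset _ enc_inj) -(card_pffun_on w0 (mem C) (mem W)).
rewrite -(card_pffun_on l0 (mem rest) (mem L)).
pose A := [set f : {ffun U -> {ffun T -> L}} | f \in pffun_on w0 (mem C) (mem W)]%SET.
pose B := [set f : {ffun U -> L} | f \in pffun_on l0 (mem rest) (mem L)]%SET.
have -> : #|pffun_on w0 (mem C) (mem W)| = #|A| by rewrite cardsE.
have -> : #|pffun_on l0 (mem rest) (mem L)| = #|B| by rewrite cardsE.
rewrite -cardsX; apply/subset_leq_card/fintype.subsetP => _ /imsetP[w wW ->].
rewrite !inE /=; apply/andP; split; apply/pffun_onP; split.
- by apply/fintype.subsetP => z; rewrite !inE ffunE; case: ifP; rewrite ?inE ?eqxx.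
- move=> _ /mapP[z + ->]; rewrite mem_enum => zC; rewrite ffunE zC.
  have /forallP/(_ z)/implyP wz : [forall z : U, tiled_at U T Z (val z) ==>
    (tile_word T (extend l0 w) (val z) \in W)] by move: wW; rewrite inE.
  by apply: wz; move: zC; rewrite /= inE.
- by apply/fintype.subsetP => u; rewrite !inE ffunE; case: ifP; rewrite ?inE ?eqxx.
- by [].
Qed.

Hypothesis tilingTZ : monotiling T Z.

(** The translates inside [U] are pairwise disjoint. *)
Lemma card_tile_centers : (#|C| * #|` T| <= #|` U|)%N.
Proof.
have [_ /trivIsetP trivZ] := tilingTZ.
rewrite (cardfE T) -(cardsT T) -cardsX (cardfE U).
pose f (p : U * T) : U := insubd p.1 (val p.2 * val p.1)%g.
have fE p : p \in finset.setX C [set: T]%SET -> val (f p) = (val p.2 * val p.1)%g.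
  rewrite !inE andbT => /andP[_ /forallP/(_ p.2) tzU].
  by rewrite /f val_insubd tzU.
rewrite -(card_in_imset (f := f)) ?max_card // => -[z t] [z' t'] pX pX' e.
have {e} e : (val t * val z = val t' * val z')%g by rewrite -(fE _ pX) -(fE _ pX') e.
have zz' : val z = val z'.
  apply/eqP/negP => /negP zz'.
  move: pX pX'; rewrite !inE /=.
  move=> /andP[/andP[/asboolP Zz _] _] /andP[/andP[/asboolP Zz' _] _].
  have /seteqP[/(_ (val t * val z)%g) + _] := trivZ _ _ Zz Zz' zz'; apply.
  by split; [exists (val t) => //; exact: valP | exists (val t') => //; exact: valP].
congr pair; first exact: val_inj.
by apply: val_inj; move: e; rewrite zz'; apply: mulIg.
Qed.

(** A position [u] outside all translates inside [U] is covered by a translate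
    [T z] that leaves [U], so [z] lies in the [T]-boundary of [U]. *)
Lemma card_untiled : 1%g \in T ->
  (#|rest| <= #|` T| * #|` fset_set (boundary [set` T] [set` U])|)%N.
Proof.
move=> T1; have [cov _] := tilingTZ.
set B := fset_set _; rewrite -(size_allpairs (fun t z => t * z)%g T B).
apply: size_preim_fset => u uR; apply/allpairsP.
have [z Zz [t /= tT tz]] : (\bigcup_(z in Z) [set (f * z)%g | f in [set` T]]) (val u).
  by rewrite cov.
exists (t, z); split=> //=; rewrite in_fset_set; last exact: boundary_finite.
apply/mem_set; have [tzU|] := boolP (tiled_at U T Z z).
  have zU : z \in U.
    by have /andP[_ /forallP/(_ [` T1]%fset)] := tzU; rewrite /= mul1g.
  move: uR; rewrite inE => /forallP/(_ [` zU]%fset) /implyP; rewrite inE.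
  by move=> /(_ tzU) /forallP/(_ [` tT]%fset) /=; rewrite tz eqxx.
rewrite /tiled_at (asboolT Zz) /= negb_forall => /existsP[t' t'z].
split; [exists t => // | exists (val t'); first exact: valP].
  by exists (val u); [exact: valP | rewrite /= -tz mulKg].
by exists (val t' * z)%g; [exact/negP | rewrite mulKg].
Qed.

Lemma log_card_tiled_words (R : realType) : 1%g \in T ->
  (0 < #|W|)%N -> (0 < #|tiled_words l0 Z W U|)%N ->
  (log2 (#|tiled_words l0 Z W U|)%:R <=
   log2 (#|W|)%:R / (#|` T|)%:R * (#|` U|)%:R +
   (#|` T|)%:R * log2 (#|L|)%:R *
     (#|` fset_set (boundary [set` T] [set` U])|)%:R :> R)%R.
Proof.
move=> T1 W0 tw0; have L0 : (0 < #|L|)%N by apply/card_gt0P; exists l0.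
have T0 : (0 < #|` T|)%N by rewrite cardfs_gt0; apply/fset0Pn; exists 1%g.
have logW : (0 <= log2 (#|W|)%:R :> R)%R by rewrite log2_ge0 // ler1n.
have logL : (0 <= log2 (#|L|)%:R :> R)%R by rewrite log2_ge0 // ler1n.
apply: (@le_trans _ _ (#|C|%:R * log2 (#|W|)%:R + #|rest|%:R * log2 (#|L|)%:R)%R).
  rewrite -!log2X ?ltr0n // -!natrX -log2M ?ltr0n ?expn_gt0 ?W0 ?L0 // -natrM.
  by apply: log2_le; rewrite ?ltr0n // ler_nat card_tiled_words.
apply: lerD.
  rewrite mulrC -mulrA ler_wpM2l // mulrC ler_pdivlMr ?ltr0n //.
  by rewrite -natrM ler_nat card_tile_centers.
rewrite mulrAC ler_wpM2r // -natrM ler_nat.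
exact: card_untiled.
Qed.

End TilingCount.

(** * Convergence of the word rate *)

Section FolnerWords.
Variables (R : realType) (G : groupType) (L : finType) (X : set (config G L)).
Variables (F : nat -> {fset G}) (Z : nat -> set G).
Hypothesis tilingFZ : folner_monotiling R F Z.
Hypothesis F1 : forall n, (0 < n)%N -> 1%g \in F n.
Hypothesis shiftX : subshift X.
Variable v0 : config G L.
Hypothesis Xv0 : X v0.
Local Open Scope ring_scope.

Let l0 : L := v0 1%g.

Definition words (U : {fset G}) : {set {ffun U -> L}} :=
  [set w | w \in word_presheaf X U]%SET.

Lemma wordsP U w : reflect (exists2 v, X v & w = restrict U v) (w \in words U).
Proof.
rewrite inE; apply: (iffP idP) => [/set_mem[v Xv <-]|[v Xv ->]]; first by exists v.
by apply/mem_set; exists v.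
Qed.

Lemma words_gt0 U : (0 < #|words U|)%N.
Proof. by apply/card_gt0P; exists (restrict U v0); apply/wordsP; exists v0. Qed.

(** The word of [v] on the translate of [T] by [z] is the word of the shifted
    configuration on [T], and the subshift is invariant. *)
Lemma words_tiled U T (Z0 : set G) :
  words U \subset tiled_words l0 Z0 (words T) U.
Proof.
apply/fintype.subsetP => _ /wordsP[v Xv ->]; rewrite inE.
apply/forallP => z; apply/implyP => /andP[_ /forallP tzU].
apply/wordsP; exists (shift_action (val z) v); first exact: shiftX.2.
by apply/ffunP => t; rewrite !ffunE extend_restrict.
Qed.

Definition word_rate n : R := log2 (#|words (F n)|)%:R / (#|` F n|)%:R.

Lemma card_tile_gt0 n : (0 < n)%N -> 0 < (#|` F n|)%:R :> R.
Proof.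
by move=> n0; rewrite ltr0n cardfs_gt0; apply/fset0Pn; exists 1%g; apply: F1.
Qed.

Lemma word_rate_ge0 n : 0 <= word_rate n.
Proof. by rewrite divr_ge0 // log2_ge0 // ler1n words_gt0. Qed.

Definition tiled_rate k n : R :=
  log2 (#|tiled_words l0 (Z k) (words (F k)) (F n)|)%:R / (#|` F n|)%:R.

Lemma word_rate_tiled k n : word_rate n <= tiled_rate k n.
Proof.
rewrite ler_wpM2r // log2_le ?ltr0n ?words_gt0 // ler_nat.
exact/subset_leq_card/words_tiled.
Qed.

(** The boundary term of [log_card_tiled_words] vanishes along a Folner
    sequence. *)
Lemma tiled_rate_near k e : (0 < k)%N -> 0 < e ->
  \forall n \near \oo, tiled_rate k n <= word_rate k + e.
Proof.
move=> k0 e0; have [folF tilF] := tilingFZ.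
pose b := (#|` F k|)%:R * log2 (#|L|)%:R : R.
have /cvgrPdist_le/(_ e e0) : (fun n => b *
    ((#|` fset_set (boundary [set` F k] [set` F n])|)%:R / (#|` F n|)%:R))
    @ \oo --> b * 0.
  by apply: cvgMr; exact: folF.
rewrite mulr0; apply: filterS2 (nbhs_infty_gt 0) => n n0.
rewrite sub0r normrN => /ler_normlW be.
have Fn0 := card_tile_gt0 n0.
rewrite /tiled_rate ler_pdivrMr //.
have tw0 : (0 < #|tiled_words l0 (Z k) (words (F k)) (F n)|)%N.
  exact: leq_trans (words_gt0 _) (subset_leq_card (words_tiled _ _ _)).
apply: le_trans (log_card_tiled_words _ _ _ _ _) _ => //.
- exact: tilF.
- exact: F1.
- exact: words_gt0.
rewrite mulrDl -/b lerD2l -ler_pdivrMr // -mulrA.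
exact: be.
Qed.

Definition word_entropy : R := inf [set word_rate k | k in [set k | (0 < k)%N]].

Lemma word_entropy_ge0 : 0 <= word_entropy.
Proof.
apply: lb_le_inf; first by exists (word_rate 1); exists 1%N.
by move=> _ [n _ <-]; exact: word_rate_ge0.
Qed.

Lemma word_entropy_le k : (0 < k)%N -> word_entropy <= word_rate k.
Proof.
move=> k0; apply: ge_inf; last by exists k.
by exists 0 => _ [n _ <-]; exact: word_rate_ge0.
Qed.

Lemma word_entropy_approx e : 0 < e ->
  exists2 k, (0 < k)%N & word_rate k < word_entropy + e.
Proof.
move=> e0; have infE : has_inf [set word_rate k | k in [set k | (0 < k)%N]].
  split; first by exists (word_rate 1); exists 1%N.
  by exists 0 => _ [n _ <-]; exact: word_rate_ge0.
by have [_ [k k0 <-] ke] := inf_adherent e0 infE; exists k.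
Qed.

(** The rate of a good tile [F k] bounds all later rates up to a small error: a
    Fekete argument with tilings in place of Euclidean division. *)
Lemma cvg_word_rate : word_rate @ \oo --> word_entropy.
Proof.
apply/cvgrPdist_le => e e0.
have [k k0 ke] := @word_entropy_approx (e / 2) (divr_gt0 e0 (ltr0Sn _ _)).
have := @tiled_rate_near k (e / 2) k0 (divr_gt0 e0 (ltr0Sn _ _)).
apply: filterS2 (nbhs_infty_gt 0) => n n0 tn.
have := word_rate_tiled k n; have := word_entropy_le n0.
by rewrite ler_norml; lra.
Qed.

End FolnerWords.

(** * Complexity of the words of a subshift *)

(** There are [2 ^ k - 1] programs of length less than [k], hence at most as many
    outputs. *)
Lemma outputs_of_short_programs (L : finType) (A : seq bool -> option (seq L)) k :
  exists2 r : seq (seq L), (size r < 2 ^ k)%N &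
    forall p w, (size p < k)%N -> A p = Some w -> w \in r.
Proof.
elim: k A => [|k IHk] A; first by exists [::].
have [r1 r1k r1P] := IHk (fun p => A (true :: p)).
have [r0 r0k r0P] := IHk (fun p => A (false :: p)).
exists (seq_of_opt (A [::]) ++ r1 ++ r0) => [|[|[] p] w /= pk Ap].
- rewrite !size_cat expnS; case: (A [::]) => /= *; lia.
- by rewrite Ap mem_cat /= inE eqxx.
- by rewrite !mem_cat (r1P p) ?orbT.
- by rewrite !mem_cat (r0P p) ?orbT.
Qed.

Lemma exists_complex_word (R : realType) (L : finType)
    (A : seq bool -> option (seq L)) (ws : seq (seq L)) k :
  uniq ws -> (2 ^ k <= size ws)%N ->
  exists2 w, w \in ws & (k%:R%:E <= K0 R A w)%E.
Proof.
move=> uws kws; apply/not_exists2P => noK.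
have [r rk rP] := outputs_of_short_programs A k.
suff /(uniq_leq_size uws) : {subset ws <= r} by rewrite leqNgt (leq_trans rk).
move=> w ww; have [//|/negP] := noK w; rewrite -ltNge.
move=> /ereal_inf_lt[_ [p Ap <-]]; rewrite lte_fin ltr_nat => pk.
exact: rP pk Ap.
Qed.

Section AsymptoticComplexity.
Variables (R : realType) (G : groupType) (idx : G -> nat).
Variables (F : nat -> {fset G}) (Z : nat -> set G).
Variables (L : finType) (A : seq bool -> option (seq L)) (X : set (config G L)).
Hypothesis compG : computable_group idx.
Hypothesis tilingFZ : folner_monotiling R F Z.
Hypothesis normalF : normal_sequence R F.
Hypothesis compFZ : computable_monotiling idx F Z.
Hypothesis optA : optimal_decompressor R A.
Hypothesis shiftX : subshift X.
Variable v0 : config G L.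
Hypothesis Xv0 : X v0.
Local Open Scope ring_scope.

Let F1 : forall n, (0 < n)%N -> 1%g \in F n := normalF.2.

(** This is where normality enters: neither the description of [n] nor any
    constant weighs against [|F n|]. *)
Lemma log_near_card e : 0 < e ->
  \forall n \near \oo, log2 n%:R <= e * (#|` F n|)%:R :> R.
Proof.
move=> e0; have /cvgryPge/(_ e^-1) := normalF.1.
apply: filterS2 (nbhs_infty_gt 1) => n n1.
have n2 := log2_nat_ge1 (R := R) n1.
rewrite ler_pdivlMr; last exact: lt_le_trans ltr01 n2.
by rewrite -ler_pdivlMl ?invr_gt0 // invrK.
Qed.

(** The constant depends on the tile [F k], since the decompressor contains the
    words of [X] on it. *)
Lemma complexity_words k : (0 < k)%N -> exists c : R,
  forall n w, (0 < n)%N -> w \in words X (F n) ->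
    (mean_complexity R idx A w <=
     ((2 * log2 n%:R + c) / (#|` F n|)%:R + tiled_rate R X F Z v0 k n)%:E)%E.
Proof.
move=> k0; have [[idx_inj _ _] [mulG compM mulGE]] := compG.
have [[codeF compF codeFE] [inZ compZ inZE]] := compFZ.
have [||||||c Kc] := @complexity_tiled_words R G L (v0 1%g) idx F (F k) (Z k)
  (words X (F k)) (fun n => codeF [tuple n]) (fun a => inZ [tuple k; a])
  (fun a b => mulG [tuple a; b]) idx_inj _ _ _ _ _ _ A optA.
- by move=> n n0; rewrite codeFE.
- by move=> x; rewrite inZE.
- by move=> x y; rewrite mulGE.
- exact: computable_total1 compF (computable_var 0).
- exact: computable_total2 compZ (computable_const k) (computable_var 0).
- exact: computable_total2 compM (computable_var 0) (computable_var 1).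
exists c => n w n0 wX; rewrite /mean_complexity /tiled_rate -mulrDl addrAC EFinM.
apply: lee_wpmul2r; first by rewrite lee_fin invr_ge0.
apply: Kc n0 _; apply: (fintype.subsetP (words_tiled _ _ _ _ _)) wX => //.
Qed.

Lemma complexity_upper e : 0 < e -> \forall n \near \oo,
  forall w, w \in words X (F n) ->
    (mean_complexity R idx A w <= (word_entropy R X F + e)%:E)%E.
Proof.
move=> e0; have e3 : 0 < e / 3 by rewrite divr_gt0.
have [k k0 ke] := word_entropy_approx F Xv0 e3.
have [c Kc] := complexity_words k0.
have tn := tiled_rate_near tilingFZ F1 shiftX Xv0 k0 e3.
(* As 1 <= log2 n from 2 on, the constant c is at most |c| log2 n. *)
have c0 : 0 < 2 + `|c| by have := normr_ge0 c; lra.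
have ln := log_near_card (divr_gt0 e3 c0).
near=> n => w wX.
have n1 : (1 < n)%N by near: n; exact: nbhs_infty_gt.
have n0 := ltnW n1; apply: (le_trans (Kc n w n0 wX)); rewrite lee_fin.
have n2 := log2_nat_ge1 (R := R) n1.
have : tiled_rate R X F Z v0 k n <= word_rate R X F k + e / 3 by near: n.
have : log2 n%:R <= e / 3 / (2 + `|c|) * (#|` F n|)%:R :> R by near: n.
rewrite [_ / _ * _]mulrAC ler_pdivlMr // => logn.
have : (2 * log2 n%:R + c) / (#|` F n|)%:R <= e / 3.
  rewrite ler_pdivrMr ?(card_tile_gt0 _ F1) //; apply: le_trans logn.
  have := ler_norm c; have := normr_ge0 c; nra.
by lra.
Unshelve. all: by end_near. Qed.

Lemma complexity_lower n : (0 < n)%N -> exists2 w, w \in words X (F n) &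
  ((word_rate R X F n - (#|` F n|)%:R^-1)%:E <= mean_complexity R idx A w)%E.
Proof.
move=> n0; have [[idx_inj _ _] _] := compG.
pose ws := [seq section_word idx w | w in words X (F n)].
pose N := #|words X (F n)|; have N0 : (0 < N)%N := words_gt0 Xv0 _.
have uws : uniq ws.
  by rewrite map_inj_uniq ?enum_uniq //; exact: section_word_inj.
have [|_ /mapP[w wX ->] Kw] := @exists_complex_word R L A ws (trunc_log 2 N) uws.
  by rewrite size_map -cardE trunc_logP.
exists w; first by rewrite mem_enum in wX.
rewrite /word_rate -[X in _ - X]mul1r -mulrBl EFinM.
apply: lee_wpmul2r; first by rewrite lee_fin invr_ge0.
apply: le_trans Kw; rewrite lee_fin lerBlDr natr1 -[leRHS]log2_expn.
by rewrite log2_le ?ltr0n // ler_nat ltnW // trunc_log_ltn.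
Qed.

Lemma asymptotic_complexityE :
  asymptotic_complexity R idx A F X = (word_entropy R X F)%:E.
Proof.
rewrite /asymptotic_complexity; set u := fun n => _.
have uE n : u n = \big[maxe/-oo%E]_(w in words X (F n)) mean_complexity R idx A w.
  by apply: eq_bigl => w; rewrite inE.
suff /cvg_limn_einf_sup[_ ->] : u @ \oo --> (word_entropy R X F)%:E by [].
have bnd e : 0 < e -> \forall n \near \oo,
    ((word_entropy R X F - e)%:E <= u n <= (word_entropy R X F + e)%:E)%E.
  move=> e0; have := complexity_upper e0; have := log_near_card e0.
  apply: filterS3 (nbhs_infty_gt 1) => n n1 ln up; have n0 := ltnW n1.
  have n2 := log2_nat_ge1 (R := R) n1.
  rewrite uE; apply/andP; split; last by apply: bigmax_le => //; rewrite leNye.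
  have [w wX Kw] := complexity_lower n0.
  apply: le_trans (le_bigmax_cond _ _ wX); apply: le_trans Kw.
  rewrite lee_fin lerB ?(word_entropy_le R F Xv0) //.
  by rewrite -div1r ler_pdivrMr ?(card_tile_gt0 _ F1) // (le_trans n2).
apply/fine_cvgP; split.
  have := bnd 1 ltr01; apply: filterS => n /andP[lo up].
  by rewrite fin_real // (lt_le_trans _ lo) ?ltNyr // (le_lt_trans up) ?ltry.
apply/cvgrPdist_le => e /bnd; apply: filterS => n /=.
case: (u n) => [r||] /andP[]; rewrite ?leye_eq ?leeNy_eq // !lee_fin => lo up /=.
by rewrite ler_norml; lra.
Qed.

End AsymptoticComplexity.

(** * Cylinders and compactness *)

Section Cylinders.
Variables (G : groupType) (L : finType).
Local Notation config := (config G L).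
Implicit Types (K U : {fset G}) (w v : config).

Definition cylinder K w : set config := [set v | forall x, x \in K -> v x = w x].

Lemma nbhs_cylinder K w : nbhs w (cylinder K w).
Proof.
have -> : cylinder K w = \bigcap_(x in [set` K]) [set v : config | v x = w x].
  by apply/seteqP; split=> v vw x xK; apply: vw.
apply: filter_bigI => x _.
have := @proj_continuous G (fun=> discrete_topology L) x w.
move=> /(_ _ (discrete_set1 (w x : discrete_topology L))).
exact.
Qed.

(** The filter of cylinders around [w] converges to [w] at every coordinate,
    hence in the product. *)
Lemma nbhs_config w (O : set config) : nbhs w O -> exists K, cylinder K w `<=` O.
Proof.
pose B := filter_from [set: {fset G}] (fun K => cylinder K w).
have BF : Filter B.
  apply: filter_from_filter => [|K1 K2 _ _]; first by exists fset0.
  exists (K1 `|` K2)%fset => // v vw.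
  by split=> x xK; apply: vw; rewrite in_fsetU xK ?orbT.
suff cvgB : B --> w by move=> /cvgB[K _ KO]; exists K.
apply/cvg_sup => x A [_ [[C _ <-] Cw CA]].
exists [fset x]%fset => // v vw; apply: CA => /=.
by rewrite vw ?in_fset1.
Qed.

Lemma compact_config (X : set config) : closed X -> compact X.
Proof.
move=> clX; apply: (@subclosed_compact _ _ [set: config]) => //.
have := @tychonoff G (fun=> discrete_topology L) (fun=> setT).
have cL (x : G) : compact [set: discrete_topology L].
    by apply: finite_compact; exact: (@finite_finset L setT).
move=> /(_ cL); congr compact; apply/seteqP; split=> //.
Qed.

(** A Lebesgue number for the cover. If each finite [K] had a bad configuration,
    the sets of bad configurations would generate a filter, and compactness
    would give it a cluster point [w0]. Some cylinder around [w0], on [K] say,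
    lies in an element of the cover, and a configuration bad for [K] enters
    it. *)
Lemma open_cover_cylinder (X : set config) (a : set (set config)) :
  closed X -> finite_open_cover X a ->
  exists K, forall w, X w -> exists2 A, a A & X `&` cylinder K w `<=` A.
Proof.
move=> clX [_ openA covA]; apply: contrapT => noK.
pose bad K := [set w | X w /\ ~ exists2 A, a A & X `&` cylinder K w `<=` A].
have badS K1 K2 : {subset K1 <= K2} -> bad K2 `<=` bad K1.
  move=> K12 w [Xw nA]; split=> // -[A aA KA]; apply: nA; exists A => //.
  by move=> v [Xv vw]; apply: KA; split=> // x /K12; exact: vw.
pose B := filter_from [set: {fset G}] bad.
have BF : Filter B.
  apply: filter_from_filter => [|K1 K2 _ _]; first by exists fset0.
  exists (K1 `|` K2)%fset => // w bw.
  by split; apply: badS bw => x xK; rewrite in_fsetU xK ?orbT.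
have PB : ProperFilter B.
  apply: filter_from_proper => K _; apply/set0P/negP => /eqP bad0.
  apply: noK; exists K => w Xw; apply: contrapT => nA.
  by have : bad K w by []; rewrite bad0.
have [|w0 [Xw0 clw0]] := compact_config clX PB; first by exists fset0 => // w [].
have [A aA Aw0] : (\bigcup_(A in a) A) w0 by rewrite covA.
have [V oV AE] := openA A aA.
have [|K KV] := @nbhs_config w0 V.
  by apply: open_nbhs_nbhs; split=> //; move: Aw0; rewrite AE => -[].
have [||w [[Xw nA] ww0]] := clw0 (bad K) (cylinder K w0).
- by exists K.
- exact: nbhs_cylinder.
apply: nA; exists A => // v [Xv vw]; rewrite AE; split=> //; apply: KV => x xK.
by rewrite vw // ww0.
Qed.

End Cylinders.

(** * Iterates of an open cover *)

Section CoverIterates.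
Variables (R : realType) (G : groupType) (L : finType) (X : set (config G L)).
Hypothesis shiftX : subshift X.
Variable v0 : config G L.
Hypothesis Xv0 : X v0.
Implicit Types (a b : set (set (config G L))) (U K F : {fset G}).

(** The element of the iterated join along [F] that picks [phi g] at [g]. *)
Definition join_cell F (phi : G -> set (config G L)) : set (config G L) :=
  X `&` [set w | forall g, g \in F -> phi g (shift_action g w)].

Lemma cover_iterateP a F B :
  cover_iterate X a F B <->
  exists2 phi, (forall g, g \in F -> a (phi g)) & B = join_cell F phi.
Proof.
rewrite /cover_iterate /join_cell.
transitivity (exists2 phi, (forall g, g \in (F : seq G) -> a (phi g)) &
    B = X `&` [set w | forall g, g \in (F : seq G) -> phi g (shift_action g w)]);
  last by [].
elim: (F : seq G) (fset_uniq F) B => [|g s IHs] /=.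
  move=> _ B; rewrite big_nil; split=> [->|[phi _ ->]]; last first.
    by apply/seteqP; split=> // w [].
  by exists (fun=> set0) => //; apply/seteqP; split.
move=> /andP[gs us] B; rewrite big_cons; split.
  move=> [_ [A aA <-] [_ /(IHs us)[phi aphi ->] <-]].
  (* The elements of F are distinct, so phi may be redefined at g. *)
  exists (fun h => if h == g then A else phi h).
    move=> h; rewrite inE; case: (eqVneq h g) => //= _; exact: aphi.
  apply/seteqP; split=> [w [[Xw Aw] [_ sw]]|w [Xw sw]].
    split=> // h; rewrite inE; case: (eqVneq h g) => [->//|_ /=]; exact: sw.
  split; split=> //; first by have := sw g; rewrite inE eqxx; apply.
  move=> h hs; have := sw h; rewrite inE hs orbT => /(_ isT).
  by case: (eqVneq h g) hs => // ->; rewrite (negbTE gs).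
move=> [phi aphi ->]; exists (X `&` shift_action g @^-1` phi g).
  by exists (phi g) => //; apply: aphi; rewrite inE eqxx.
exists (X `&` [set w | forall h, h \in s -> phi h (shift_action h w)]).
  apply/(IHs us); exists phi => // h hs; apply: aphi; rewrite inE hs orbT //.
apply/seteqP; split=> [w [[Xw gw] [_ sw]]|w [Xw sw]].
  by split=> // h; rewrite inE => /predU1P[->//|]; exact: sw.
split; split=> //; first by apply: sw; rewrite inE eqxx.
by move=> h hs; apply: sw; rewrite inE hs orbT.
Qed.

Lemma cover_iterate_finite a F : finite_set a -> finite_set (cover_iterate X a F).
Proof.
move=> fa; rewrite /cover_iterate; elim: (F : seq G) => [|g s IHs].
  by rewrite big_nil; exact: finite_set1.
by rewrite big_cons; apply: finite_image2 => //; exact: finite_image.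
Qed.

Let subcover_sizes b : set R :=
  [set (#|` fset_set c|)%:R%R | c in [set c | c `<=` b /\ covers X c]].

Let subcover_gt0 b c :
  finite_set b -> c `<=` b -> covers X c -> (0 < #|` fset_set c|)%N.
Proof.
move=> fb cb covc; rewrite cardfs_gt0; apply/fset0Pn.
have [A cA Av0] : (\bigcup_(A in c) A) v0 by rewrite covc.
exists A; rewrite in_fset_set; last exact: sub_finite_set fb.
exact/mem_set.
Qed.

Let subcover_lbound b : finite_set b -> lbound (subcover_sizes b) (1%R : R).
Proof.
move=> fb _ [c [cb covc] <-]; rewrite ler1n; exact: subcover_gt0 fb cb covc.
Qed.

Lemma cover_entropy_le b c N : finite_set b -> c `<=` b -> covers X c ->
  (#|` fset_set c| <= N)%N -> (cover_entropy R X b <= log2 N%:R%R)%R.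
Proof.
move=> fb cb covc cN; have csz : subcover_sizes b (#|` fset_set c|)%:R%R by exists c.
apply: log2_le.
  apply: lt_le_trans ltr01 _; apply: lb_le_inf; last exact: subcover_lbound.
  by exists (#|` fset_set c|)%:R%R.
apply: (@le_trans _ _ (#|` fset_set c|)%:R%R); last by rewrite ler_nat.
by apply: ge_inf => //; exists 1%R; exact: subcover_lbound.
Qed.

Lemma cover_entropy_ge b N : (0 < N)%N -> covers X b ->
  (forall c, c `<=` b -> covers X c -> (N <= #|` fset_set c|)%N) ->
  (log2 N%:R%R <= cover_entropy R X b)%R.
Proof.
move=> N0 covb Nmin; apply: log2_le; first by rewrite ltr0n.
apply: lb_le_inf; first by exists (#|` fset_set b|)%:R%R; exists b => //; split.
by move=> _ [c [cb covc] <-]; rewrite ler_nat Nmin.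
Qed.

(** If the words on [K] refine the cover, then the words on [K F] refine its
    iterate along [F]; one element for each word is enough to cover [X]. *)
Lemma subcover_words a F K U : (forall g x, g \in F -> x \in K -> (x * g)%g \in U) ->
  (forall w, X w -> exists2 A, a A & X `&` cylinder K w `<=` A) ->
  exists c, [/\ c `<=` cover_iterate X a F, covers X c &
                (#|` fset_set c| <= #|words X U|)%N].
Proof.
move=> KFU aK.
have pick_cell (u : {ffun U -> L}) : exists B, u \in words X U ->
    cover_iterate X a F B /\ (forall w, X w -> restrict U w = u -> B w).
  have [/wordsP[w Xw ->]|] := boolP (u \in words X U); last by exists set0.
  have cell g : exists A, a A /\ X `&` cylinder K (shift_action g w) `<=` A.
    by have [A aA KA] := aK _ (shiftX.2 g w Xw); exists A.
  have /boolp.choice[phi phiP] := cell.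
  exists (join_cell F phi) => _; split.
    by apply/cover_iterateP; exists phi => // g _; have [] := phiP g.
  move=> v Xv vw; split=> // g gF; have [_] := phiP g; apply.
  split=> [|x xK]; first exact: shiftX.2.
  have xgU := KFU g x gF xK.
  by have /ffunP/(_ [` xgU]%fset) := vw; rewrite !ffunE.
have /boolp.choice[cell cellP] := pick_cell.
exists [set` [fset cell u | u in words X U]%fset]; split.
- by move=> _ /imfsetP[u /= uX ->]; have [] := cellP u uX.
- apply/seteqP; split=> [w [_ /imfsetP[u /= uX ->]]|w Xw].
    by have [/cover_iterateP[phi _ ->] _] := cellP u uX => -[].
  have uX : restrict U w \in words X U by apply/wordsP; exists w.
  exists (cell (restrict U w)); first exact: in_imfset.
  by have [_] := cellP _ uX; apply.
rewrite set_fsetK; apply: leq_trans (leq_imfset_card _ _ _) _.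
by rewrite cardE.
Qed.

End CoverIterates.

(** * Topological entropy *)

Section TopologicalEntropy.
Variables (R : realType) (G : groupType) (L : finType) (X : set (config G L)).
Variables (F : nat -> {fset G}) (Z : nat -> set G).
Hypothesis tilingFZ : folner_monotiling R F Z.
Hypothesis F1 : forall n, (0 < n)%N -> 1%g \in F n.
Hypothesis shiftX : subshift X.
Variable v0 : config G L.
Hypothesis Xv0 : X v0.
Local Open Scope ring_scope.

Lemma card_words_extend (U V : {fset G}) :
  (#|words X (U `|` V)%fset| <= #|words X U| * #|L| ^ #|` (V `\` U)%fset|)%N.
Proof.
pose l0 := v0 1%g; set UV := (U `|` V)%fset.
pose enc (u : {ffun UV -> L}) :=
  (restrict U (extend l0 u), restrict (V `\` U)%fset (extend l0 u)).
have enc_inj : injective enc.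
  move=> u u' [/ffunP eU /ffunP eV]; apply/ffunP => x.
  have [xU|xU] := boolP (val x \in U).
    by have := eU [` xU]%fset; rewrite !ffunE /= !extendE.
  have xV : val x \in (V `\` U)%fset.
    by have := valP x; rewrite !inE (negbTE xU).
  by have := eV [` xV]%fset; rewrite !ffunE /= !extendE.
rewrite -(card_imset _ enc_inj) (cardfE (V `\` U)%fset) -card_ffun -cardsT -cardsX.
apply/subset_leq_card/fintype.subsetP => _ /imsetP[_ /wordsP[v Xv ->] ->].
rewrite !inE andbT; apply/mem_set; exists v => //.
by apply/ffunP => x; rewrite !ffunE extend_restrict // in_fsetU (valP x).
Qed.

(** A point of [K U] outside [U] is moved into [U] by the inverse of an element
    of [K] while the identity leaves it outside. *)
Lemma card_thickening (K U : {fset G}) :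
  (#|` ([fset (x * g)%g | x in K, g in U] `\` U)%fset| <=
   #|` fset_set (boundary [set` (1%g |` [fset x^-1%g | x in K])%fset] [set` U])|)%N.
Proof.
apply: fsubset_leq_card; apply/fsubsetP => y.
move=> /fsetDP[/imfset2P[x /= xK [g /= gU ->]] xgU].
rewrite in_fset_set; last exact: boundary_finite.
apply/mem_set; split; last first.
  exists 1%g; first by rewrite /= fset1U1.
  by exists (x * g)%g; [exact/negP | rewrite invg1 mul1g].
exists x^-1%g; first by rewrite /= in_fset1U in_imfset ?orbT.
by exists g => //; rewrite invgK.
Qed.

(** The iterate along [F n] needs no more elements than there are words on the
    thickening of [F n] by [K], whose rate differs from that of [F n] by a
    boundary term. *)
Lemma entropy_of_cover_le a : finite_open_cover X a ->
  entropy_of_cover R F X a <= word_entropy R X F.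
Proof.
move=> cova; have [K aK] := open_cover_cylinder shiftX.1 cova.
have [fa _ _] := cova.
have L0 : (0 < #|L|)%N by apply/card_gt0P; exists (v0 1%g).
have h0 : 0 <= word_entropy R X F by exact: (word_entropy_ge0 R F Xv0).
rewrite /entropy_of_cover; set H := fun n => _.
(* The value of limn at a divergent sequence is 0. *)
have [cvgH|/dvgP ->] := pselect (cvgn H); last exact: h0.
pose K' := (1%g |` [fset x^-1%g | x in K])%fset.
pose b n : R := (#|` fset_set (boundary [set` K'] [set` F n])|)%:R / (#|` F n|)%:R.
have cvgb : word_rate R X F n + log2 (#|L|)%:R * b n @[n --> \oo] -->
    word_entropy R X F + log2 (#|L|)%:R * 0.
  apply: cvgD; first exact: (cvg_word_rate tilingFZ F1 shiftX Xv0).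
  by apply: cvgMr; exact: tilingFZ.1.
rewrite -[word_entropy R X F]addr0 -[X in _ + X](mulr0 (log2 (#|L|)%:R)).
rewrite -(cvg_lim _ cvgb) //; apply: ler_lim => //; first by apply/cvgP: cvgb.
apply: nearW => n; rewrite /H /word_rate /b mulrA -mulrDl ler_wpM2r //.
pose V := [fset (x * g)%g | x in K, g in F n]%fset.
have [g x gF xK||c [ca covc cU]] :=
  @subcover_words _ _ _ shiftX a (F n) K (F n `|` V)%fset.
- by rewrite in_fsetU in_imfset2 ?orbT.
- exact: aK.
apply: (le_trans (cover_entropy_le R Xv0 (cover_iterate_finite _ _ fa) ca covc
  (leq_trans cU (card_words_extend _ _)))).
rewrite natrM log2M ?ltr0n ?expn_gt0 ?L0 ?(words_gt0 Xv0) // lerD2l.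
rewrite natrX log2X ?ltr0n // mulrC ler_wpM2l ?log2_ge0 ?ler1n //.
by rewrite ler_nat card_thickening.
Qed.

Definition symbol_cover : set (set (config G L)) :=
  [set X `&` [set w | w 1%g = l] | l in [set: L]].

Lemma symbol_cover_open : finite_open_cover X symbol_cover.
Proof.
split=> [|_ [l _ <-]|]; first by apply: finite_image; exact: (@finite_finset L setT).
  exists [set w | w 1%g = l] => //; rewrite openE => w wl.
  apply: filterS (nbhs_cylinder [fset 1%g]%fset w).
  by move=> v vw /=; rewrite vw ?in_fset1.
apply/seteqP; split=> [w [_ [l _ <-] []]|w Xw] //.
by exists (X `&` [set v | v 1%g = w 1%g]) => //; exists (w 1%g).
Qed.

(** The elements of the iterate along [U] are the cylinders of the words on [U],
    so a subcover has to contain one for each word of [X]. *)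
Lemma cover_entropy_symbol_cover (U : {fset G}) :
  cover_entropy R X (cover_iterate X symbol_cover U) = log2 (#|words X U|)%:R.
Proof.
have cell w : X w ->
    exists2 A, symbol_cover A & X `&` cylinder [fset 1%g]%fset w `<=` A.
  move=> Xw; exists (X `&` [set v | v 1%g = w 1%g]); first by exists (w 1%g).
  by move=> v [Xv vw]; split=> //=; rewrite vw ?in_fset1.
have [g x gU /fset1P->|c [ci covc cU]] :=
  subcover_words shiftX (F := U) (U := U) _ cell.
  by rewrite mul1g.
have [fs _ _] := symbol_cover_open.
have fi := cover_iterate_finite X U fs.
apply/le_anti/andP; split; first exact: (cover_entropy_le R Xv0 fi ci covc cU).
apply: cover_entropy_ge; first exact: words_gt0 Xv0 _.
  apply/seteqP; split=> [w [A /cover_iterateP[phi _ ->] []]|w Xw] //.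
  have : (\bigcup_(A in c) A) w by rewrite covc.
  by move=> [A /ci iA Aw]; exists A.
move=> d di covd; have fd : finite_set d by apply: sub_finite_set fi.
have pick_cell (u : {ffun U -> L}) : exists A, u \in words X U ->
    d A /\ exists2 w, A w & restrict U w = u.
  have [/wordsP[w Xw ->]|] := boolP (u \in words X U); last by exists set0.
  have [A dA Aw] : (\bigcup_(A in d) A) w by rewrite covd.
  by exists A => _; split=> //; exists w.
have /boolp.choice[A AP] := pick_cell.
have A_inj : {in words X U &, injective A}.
  move=> u u' /AP[dA [w Aw wu]] /AP[_ [w' Aw' wu']] e.
  have /di/cover_iterateP[phi phiP AE] := dA.
  move: Aw' Aw; rewrite -e AE -wu -wu' => -[_ sw'] [_ sw].
  apply/ffunP => x; rewrite !ffunE.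
  have [l _ lE] := phiP _ (valP x).
  have := sw _ (valP x); have := sw' _ (valP x); rewrite -lE => -[_ /=] + [_ /=].
  by rewrite /shift_action mul1g => -> ->.
rewrite cardE -(size_map A); apply: uniq_leq_size.
  by rewrite map_inj_in_uniq ?enum_uniq // => u u'; rewrite !mem_enum; exact: A_inj.
move=> _ /mapP[u + ->]; rewrite mem_enum => /AP[dA _].
by rewrite in_fset_set //; apply/mem_set.
Qed.

Lemma topological_entropyE :
  topological_entropy R F X = (word_entropy R X F)%:E.
Proof.
apply/le_anti/andP; split.
  apply: ge_ereal_sup => _ [a cova <-]; rewrite lee_fin.
  exact: entropy_of_cover_le.
apply: ereal_sup_ubound; exists symbol_cover; first exact: symbol_cover_open.
congr EFin; rewrite /entropy_of_cover.
under eq_fun do rewrite cover_entropy_symbol_cover.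
exact: cvg_lim (cvg_word_rate tilingFZ F1 shiftX Xv0).
Qed.

End TopologicalEntropy.

Theorem theorem3p1 (R : realType) (G : groupType) (idx : G -> nat)
  (F : nat -> {fset G}) (Z : nat -> set G)
  (L : finType) (Astar : seq bool -> option (seq L)) (X : set (config G L))
  (infG : ([set: G] #= [set: nat])%card)
  (compG : computable_group idx)
  (tilingFZ : folner_monotiling R F Z)
  (normalF : normal_sequence R F)
  (compFZ : computable_monotiling idx F Z)
  (optA : optimal_decompressor R Astar)
  (shiftX : subshift X) (X0 : X !=set0) :
  asymptotic_complexity R idx Astar F X = topological_entropy R F X.
Proof.
have [v0 Xv0] := X0.
rewrite (asymptotic_complexityE compG tilingFZ normalF compFZ optA shiftX Xv0).
by rewrite (topological_entropyE tilingFZ normalF.2 shiftX Xv0).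
Qed.
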